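(* Let $m\ge1$ be an integer, let $D\subset\mathbb{R}^2$ be a compact convex domain and let $f\in C^{m,1}(D)$. For all non-negative integers $\alpha,\beta$ with $1\le\alpha+\beta\le m$ and all vertices $V_1,V_2,V_3\in D$ of a non-degenerate triangle, $$\frac{\partial^{\alpha+\beta}P_{m}^{[\Delta_2(V_1,V_2,V_3);V_1]}[f]}{\partial x^{\alpha}\partial y^{\beta}}(V_1)=\frac{\partial^{\alpha+\beta}f}{\partial x^{\alpha}\partial y^{\beta}}(V_1)+O\left(r^{m+1-(\alpha+\beta)}\right),$$ where $r=\max\{\|V_1-V_2\|_2,\|V_1-V_3\|_2,\|V_2-V_3\|_2\}$ and the constant implicit in $O(\cdot)$ depends only on $f,m,\alpha,\beta$ and on the quantity $r^2S$ with $S^{-1}=|A(V_1,V_2,V_3)|$ (which depends only on the shape of the triangle).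
   Context: Function classes. $C^m(D)$ is the class of functions of class $C^m$ on $D$ in the sense of Whitney (restrictions to $D$ of $C^m$ functions on $\mathbb{R}^2$). $C^{m,1}(D)$ is the class of $f\in C^m(D)$ whose partial derivatives $\frac{\partial^m f}{\partial x^{m-j}\partial y^j}$, $j=0,\dots,m$, are Lipschitz continuous on $D$. Triangle notation. $A(P,Q,R)$ is the determinant of the $3\times3$ matrix whose columns are $(1,P)^T,(1,Q)^T,(1,R)^T$. The barycentric coordinates of $\boldsymbol{x}\in\mathbb{R}^2$ used below are $\lambda_2=\frac{A(V_1,\boldsymbol{x},V_3)}{A(V_1,V_2,V_3)}$, $\lambda_3=\frac{A(V_1,V_2,\boldsymbol{x})}{A(V_1,V_2,V_3)}$. $\Delta_2(V_1,V_2,V_3)$ is the convex hull of $V_1,V_2,V_3$. For $i\ne j$, $D_{ij}f=(V_i-V_j)\cdot\nabla f$, and for $\beta=(\beta_1,\beta_2)$ with non-negative integer components, $D_1^\beta=D_{21}^{\beta_1}D_{31}^{\beta_2}$, $D_2^\beta=D_{12}^{\beta_1}D_{32}^{\beta_2}$, $D_3^\beta=D_{13}^{\beta_1}D_{23}^{\beta_2}$. Bernoulli polynomials: $B_0(x)=1$, $B_n'(x)=nB_{n-1}(x)$ and $\int_0^1B_n(x)\,dx=0$ for $n\ge1$; $S_k(x)=B_k(x)-B_k(0)$. Generalized Taylor polynomial: $$\begin{aligned}P_{m}^{[\Delta_2(V_1,V_2,V_3);V_1]}[f](\boldsymbol{x})=&f(V_1)+\sum_{j=1}^{m}\left(D_1^{(0,j-1)}f(V_3)-D_1^{(0,j-1)}f(V_1)\right)\frac{S_j(\lambda_2+\lambda_3)}{j!}\\&+\sum_{i=1}^{m}\sum_{j=1}^{m-i+1}\Big((-1)^{i+j}\big(D_2^{(j-1,i-1)}f(V_2)-D_2^{(j-1,i-1)}f(V_1)\big)\\&\quad+(-1)^j\big(D_3^{(j-1,i-1)}f(V_3)-D_3^{(j-1,i-1)}f(V_1)\big)\Big)\frac{(\lambda_2+\lambda_3)^{i-1}S_i\left(\frac{\lambda_2}{\lambda_2+\lambda_3}\right)}{i!}\frac{S_j(\lambda_2+\lambda_3)}{j!},\end{aligned}$$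 where the products $(\lambda_2+\lambda_3)^{i-1}S_i\left(\frac{\lambda_2}{\lambda_2+\lambda_3}\right)S_j(\lambda_2+\lambda_3)$ are understood as polynomials in $\lambda_2,\lambda_3$ also where $\lambda_2+\lambda_3=0$. *)

(* Defs.v *)
From Stdlib Require Import Reals Lra Lia List Factorial.
From Coquelicot Require Import Coquelicot.
Open Scope R_scope.

Definition compact_set {T : UniformSpace} (D : T -> Prop) : Prop :=
  forall (I : Type) (U : I -> T -> Prop),
    (forall i, open (U i)) ->
    (forall p, D p -> exists i, U i p) ->
    exists l : list I, forall p, D p -> exists i, In i l /\ U i p.

Definition convex_set (D : R * R -> Prop) : Prop :=
  forall P Q t, D P -> D Q -> 0 <= t <= 1 ->
    D ((1 - t) * fst P + t * fst Q, (1 - t) * snd P + t * snd Q).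

(** "Domain" is read as "with nonempty interior"; a compact convex set with
    nonempty interior is the closure of its interior. *)
Definition compact_convex_domain (D : R * R -> Prop) : Prop :=
  compact_set D /\ convex_set D /\ exists P : R * R, locally P D.

(** A function on [D] is represented by a total function [f : R * R -> R], of
    which only the values on [D] are ever used.
    [F] is of class C^m on the whole plane and restricts to [f] on [D].  For a
    domain [D] as above, the partial derivatives of order at most [m] of [F] at
    the points of [D] depend only on [f]: they are the partial derivatives of
    [f] on [D]. *)
Definition Cm_extension (m : nat) (D : R * R -> Prop) (f : R * R -> R)
    (F : R -> R -> R) : Prop :=
  (forall x y, ex_diff_n F m x y) /\
  (forall P, D P -> F (fst P) (snd P) = f P).

Definition dist2 (P Q : R * R) : R := dist_euc (fst P) (snd P) (fst Q) (snd Q).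

Definition lipschitz_on (D : R * R -> Prop) (g : R -> R -> R) : Prop :=
  exists L : R, forall P Q, D P -> D Q ->
    Rabs (g (fst P) (snd P) - g (fst Q) (snd Q)) <= L * dist2 P Q.

Definition Cm1_on (m : nat) (D : R * R -> Prop) (f : R * R -> R) : Prop :=
  exists F, Cm_extension m D f F /\
    forall j, (j <= m)%nat -> lipschitz_on D (partial_derive (m - j) j F).

(** The determinant of the matrix with columns [(1, P)], [(1, Q)], [(1, W)],
    expanded along its row of ones. *)
Definition A (P Q W : R * R) : R :=
  (fst Q * snd W - fst W * snd Q)
  - (fst P * snd W - fst W * snd P)
  + (fst P * snd Q - fst Q * snd P).

Definition diam (V1 V2 V3 : R * R) : R :=
  Rmax (dist2 V1 V2) (Rmax (dist2 V1 V3) (dist2 V2 V3)).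

Definition lambda2 (V1 V2 V3 X : R * R) : R := A V1 X V3 / A V1 V2 V3.
Definition lambda3 (V1 V2 V3 X : R * R) : R := A V1 V2 X / A V1 V2 V3.

(** [Ddir P Q f] is [(P - Q) . grad f]. *)
Definition Ddir (P Q : R * R) (f : R -> R -> R) : R -> R -> R :=
  fun x y => (fst P - fst Q) * Derive (fun t => f t y) x
           + (snd P - snd Q) * Derive (fun t => f x t) y.

Definition Dpow (P Q : R * R) (n : nat) (f : R -> R -> R) : R -> R -> R :=
  Nat.iter n (Ddir P Q) f.

(** [Dtri V P Q (b1, b2)] is the operator [D_(P V)^b1 D_(Q V)^b2] attached to
    the vertex [V], so that [D_1], [D_2], [D_3] are respectively
    [Dtri V1 V2 V3], [Dtri V2 V1 V3] and [Dtri V3 V1 V2]. *)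
Definition Dtri (V P Q : R * R) (b : nat * nat) (f : R -> R -> R) :
    R * R -> R :=
  fun X => Dpow P V (fst b) (Dpow Q V (snd b) f) (fst X) (snd X).

(** [bernoulli_coef n k] is the coefficient of [x ^ k] in [B_n]: those with
    [k > 0] come from [B_n' = n B_(n-1)], the constant one from the vanishing
    of the integral of [B_n] over [0, 1]. *)
Fixpoint bernoulli_coef (n : nat) : nat -> R :=
  match n with
  | O => fun k => match k with O => 1 | S _ => 0 end
  | S p => fun k =>
      match k with
      | O => - sum_n (fun l => INR (S p) * bernoulli_coef p l / INR (S l)
                               / INR (S (S l))) p
      | S l => INR (S p) * bernoulli_coef p l / INR (S l)
      end
  end.

Definition bernoulli (n : nat) (x : R) : R :=
  sum_n (fun k => bernoulli_coef n k * x ^ k) n.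

Lemma bernoulli_0 (x : R) : bernoulli 0 x = 1.
Proof. unfold bernoulli; rewrite sum_O; simpl; ring. Qed.

Lemma bernoulli_shift (p : nat) (x : R) :
  bernoulli (S p) x = bernoulli_coef (S p) 0
    + sum_n (fun l => bernoulli_coef (S p) (S l) * x ^ S l) p.
Proof.
unfold bernoulli, sum_n.
rewrite sum_Sn_m by lia; rewrite <- sum_n_m_S.
simpl (x ^ 0); rewrite Rmult_1_r; reflexivity.
Qed.

Lemma is_derive_monomial (c x : R) (n : nat) :
  is_derive (fun t => c * t ^ S n) x (c * INR (S n) * x ^ n).
Proof.
evar_last.
  apply (is_derive_scal (fun t => t ^ S n)), is_derive_pow, is_derive_id.
unfold one; simpl (pred _); change (c * (INR (S n) * 1 * x ^ n)
  = c * INR (S n) * x ^ n); ring.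
Qed.

Lemma bernoulli_derive (p : nat) (x : R) :
  is_derive (bernoulli (S p)) x (INR (S p) * bernoulli p x).
Proof.
apply is_derive_ext with (fun x => bernoulli_coef (S p) 0
    + sum_n (fun l => bernoulli_coef (S p) (S l) * x ^ S l) p).
  intros t; symmetry; apply bernoulli_shift.
replace (INR (S p) * bernoulli p x)
  with (0 + sum_n (fun l => INR (S p) * (bernoulli_coef p l * x ^ l)) p).
2: { rewrite Rplus_0_l.
     apply (sum_n_mult_l (K := R_Ring) (INR (S p))
       (fun l => bernoulli_coef p l * x ^ l)). }
apply (is_derive_plus (fun _ : R => bernoulli_coef (S p) 0)
  (fun x => sum_n (fun l => bernoulli_coef (S p) (S l) * x ^ S l) p)).
  apply (is_derive_const (K := R_AbsRing) (V := R_NormedModule)).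
apply (is_derive_sum_n (K := R_AbsRing) (V := R_NormedModule)
  (fun l x => bernoulli_coef (S p) (S l) * x ^ S l)).
intros k _.
assert (Hk : INR (S k) <> 0) by (apply not_0_INR; lia).
change (bernoulli_coef (S p) (S k))
  with (INR (S p) * bernoulli_coef p k / INR (S k)).
evar_last; [apply is_derive_monomial|].
cbv beta; generalize (bernoulli_coef p k); intros c.
change (INR (S p) * c / INR (S k) * INR (S k) * x ^ k
  = INR (S p) * (c * x ^ k)); field; exact Hk.
Qed.

Lemma bernoulli_int (p : nat) : is_RInt (bernoulli (S p)) 0 1 0.
Proof.
set (G := fun x => bernoulli_coef (S p) 0 * x
  + sum_n (fun l => bernoulli_coef (S p) (S l) / INR (S (S l)) * x ^ S (S l)) p).
assert (HG : forall x, is_derive G x (bernoulli (S p) x)).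
{ intros x; rewrite bernoulli_shift.
  apply (is_derive_plus (fun x : R => bernoulli_coef (S p) 0 * x)
    (fun x => sum_n (fun l => bernoulli_coef (S p) (S l) / INR (S (S l))
                              * x ^ S (S l)) p)).
    evar_last; [apply (is_derive_scal (fun x : R => x)), is_derive_id|].
    change (bernoulli_coef (S p) 0 * 1 = bernoulli_coef (S p) 0); ring.
  apply (is_derive_sum_n (K := R_AbsRing) (V := R_NormedModule)
    (fun l x => bernoulli_coef (S p) (S l) / INR (S (S l)) * x ^ S (S l))).
  intros k _.
  assert (Hk : INR (S (S k)) <> 0) by (apply not_0_INR; lia).
  generalize (bernoulli_coef (S p) (S k)); intros c.
  evar_last; [apply is_derive_monomial|].
  change (c / INR (S (S k)) * INR (S (S k)) * x ^ S k = c * x ^ S k).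
  field; exact Hk. }
replace 0 with (minus (G 1) (G 0)) at 2.
  apply (is_RInt_derive (V := R_CompleteNormedModule) G).
    intros x _; apply HG.
  intros x _; apply (ex_derive_continuous (K := R_AbsRing) (V := R_NormedModule)).
  eexists; apply bernoulli_derive.
unfold G.
rewrite (sum_n_ext (fun l => bernoulli_coef (S p) (S l) / INR (S (S l)) * 0 ^ S (S l))
  (fun _ => 0)) by (intros; simpl; ring).
rewrite (sum_n_ext (fun l => bernoulli_coef (S p) (S l) / INR (S (S l)) * 1 ^ S (S l))
  (fun l => INR (S p) * bernoulli_coef p l / INR (S l) / INR (S (S l)))).
2: { intros l; rewrite pow1, Rmult_1_r; reflexivity. }
rewrite sum_n_const.
unfold minus, plus, opp; simpl; ring.
Qed.

Definition S_poly (k : nat) (x : R) : R := bernoulli k x - bernoulli k 0.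

(** [u ^ (i - 1) * S_i (v / u) * S_j u] as a polynomial in [u] and [v], for
    [i, j >= 1]: since [S_i] and [S_j] have no constant term, it is the product
    of the polynomials [u ^ i * S_i (v / u)] and [S_j u / u]. *)
Definition S_prod (i j : nat) (u v : R) : R :=
  sum_n_m (fun k => bernoulli_coef i k * v ^ k * u ^ (i - k)) 1 i
  * sum_n_m (fun l => bernoulli_coef j l * u ^ (l - 1)) 1 j.

Lemma S_poly_sum (k : nat) (x : R) :
  S_poly k x = sum_n_m (fun l => bernoulli_coef k l * x ^ l) 1 k.
Proof.
unfold S_poly, bernoulli, sum_n.
destruct k as [|p].
  rewrite !sum_n_n, sum_n_m_zero by lia; unfold zero; simpl; ring.
rewrite !(sum_Sn_m _ 0 (S p)) by lia.
rewrite (sum_n_m_ext_loc (fun l => bernoulli_coef (S p) l * 0 ^ l)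
  (fun _ => zero) 1 (S p)).
  rewrite sum_n_m_const_zero; unfold plus, zero; simpl; ring.
intros l Hl; rewrite pow_i by lia; unfold zero; simpl; ring.
Qed.

Lemma S_prodE (i j : nat) (u v : R) :
  (1 <= i)%nat -> (1 <= j)%nat -> u <> 0 ->
  S_prod i j u v = u ^ (i - 1) * S_poly i (v / u) * S_poly j u.
Proof.
intros Hi Hj Hu; unfold S_prod; rewrite !S_poly_sum.
assert (E1 : sum_n_m (fun k => bernoulli_coef i k * v ^ k * u ^ (i - k)) 1 i
  = u ^ i * sum_n_m (fun l => bernoulli_coef i l * (v / u) ^ l) 1 i).
{ rewrite <- (sum_n_m_mult_l (K := R_Ring) (u ^ i)).
  apply sum_n_m_ext_loc; intros k Hk; unfold mult; simpl.
  replace (u ^ i) with (u ^ (i - k) * u ^ k)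
    by (rewrite <- pow_add; f_equal; lia).
  unfold Rdiv; rewrite Rpow_mult_distr, pow_inv; field.
  apply pow_nonzero, Hu. }
assert (E2 : sum_n_m (fun l => bernoulli_coef j l * u ^ l) 1 j
  = u * sum_n_m (fun l => bernoulli_coef j l * u ^ (l - 1)) 1 j).
{ rewrite <- (sum_n_m_mult_l (K := R_Ring) u).
  apply sum_n_m_ext_loc; intros k Hk; unfold mult; simpl.
  replace (u ^ k) with (u * u ^ (k - 1)); [ring|].
  replace k with (S (k - 1)) at 2 by lia; reflexivity. }
rewrite E1, E2.
replace (u ^ i) with (u * u ^ (i - 1)); [ring|].
replace i with (S (i - 1)) at 2 by lia; reflexivity.
Qed.

Definition gen_taylor (m : nat) (V1 V2 V3 : R * R) (f : R -> R -> R) :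
    R -> R -> R :=
  fun x y =>
    let l2 := lambda2 V1 V2 V3 (x, y) in
    let l3 := lambda3 V1 V2 V3 (x, y) in
    let D1 b := Dtri V1 V2 V3 b f in
    let D2 b := Dtri V2 V1 V3 b f in
    let D3 b := Dtri V3 V1 V2 b f in
    f (fst V1) (snd V1)
    + sum_n_m (fun j =>
        (D1 (0, j - 1)%nat V3 - D1 (0, j - 1)%nat V1)
        * (S_poly j (l2 + l3) / INR (fact j))) 1 m
    + sum_n_m (fun i =>
        sum_n_m (fun j =>
          ((-1) ^ (i + j)
             * (D2 (j - 1, i - 1)%nat V2 - D2 (j - 1, i - 1)%nat V1)
           + (-1) ^ j
             * (D3 (j - 1, i - 1)%nat V3 - D3 (j - 1, i - 1)%nat V1))
          * (S_prod i j (l2 + l3) l2 / (INR (fact i) * INR (fact j))))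
          1 (m - i + 1)) 1 m.

(* Main.v *)
Require Import Defs.
From Stdlib Require Import Reals Lra Lia Factorial FunctionalExtensionality.
From Coquelicot Require Import Coquelicot.
Open Scope R_scope.

(** The operator [gen_taylor m V1 V2 V3] is linear and leaves the polynomials
    of degree at most [m] unchanged.  Let [T] be the Taylor polynomial of degree
    [m] of [F] at [V1] and [g = F - T].  Then [gen_taylor F - T] is
    [gen_taylor g], and [T] has the same derivatives as [F] at [V1], so that the
    error is the derivative of [gen_taylor g] at [V1].

    Reproduction of polynomials ([gen_taylor_reproduces]) comes from one
    variable: a polynomial [h] of degree at most [m] equals
    [h 0 + sum_(1 <= j <= m) (h^(j-1) 1 - h^(j-1) 0) S_j / j!]
    ([bernoulli_expansion]).  A point with [u = lambda2 + lambda3] lies on the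
    segment parallel to V2 V3 cut by the edges at V1; expanding along this
    segment, and then along the two edges the derivatives met at its ends, gives
    exactly [gen_taylor].

    As for the error, the derivatives of [F] of order [m] are Lipschitz on the
    convex set [D] and those of [g] of order at most [m] vanish at [V1]; hence a
    derivative of [g] of order [k] at a vertex is [O(r^(m+1-k))].  In
    [gen_taylor g] it is taken along [k] edges, of length at most [r], so that
    all the coefficients are [O(r^(m+1))] ([Dtri_flat_bound]).  They multiply
    fixed polynomials in the affine functions [lambda2] and [lambda2 + lambda3],
    whose first derivatives are at most [r S], with [S = 1 / |A(V1, V2, V3)|]
    ([partial_derive_comp_affine_le]).  With [n = alpha + beta] the error is
    therefore [O(r^(m+1) (r S)^n) = O((r^2 S)^n r^(m+1-n))].

    The Lipschitz bound is given for one extension of [f] and has to hold for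
    all: two extensions have the same derivatives on [D], because [D] lies in the
    closure of its interior ([partial_derive_unique_on]). *)

(** * Functions of class C^n on the plane *)

Definition Dx (f : R -> R -> R) : R -> R -> R :=
  fun x y => Derive (fun t => f t y) x.
Definition Dy (f : R -> R -> R) : R -> R -> R :=
  fun x y => Derive (fun t => f x t) y.
Definition Cn (n : nat) (f : R -> R -> R) : Prop :=
  forall x y, ex_diff_n f n x y.
Definition smooth (f : R -> R -> R) : Prop := forall n, Cn n f.

(** Linear combinations as a single operation: directional derivatives,
    remainders and affine changes of variables are all instances. *)
Definition lin (a : R) (f : R -> R -> R) (b : R) (g : R -> R -> R) :
  R -> R -> R := fun x y => a * f x y + b * g x y.

Lemma fun2_ext (f g : R -> R -> R) : (forall x y, f x y = g x y) -> f = g.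
Proof.
intros H; apply functional_extensionality; intros x.
apply functional_extensionality; intros y; apply H.
Qed.

Lemma Cn_le (n k : nat) f : (k <= n)%nat -> Cn n f -> Cn k f.
Proof. intros H Hf x y; apply (ex_diff_n_m n); auto. Qed.

Lemma Cn_Dx n f : Cn (S n) f -> Cn n (Dx f).
Proof. intros H x y; apply (ex_diff_n_deriv_aux1 f n x y (H x y)). Qed.

Lemma Cn_Dy n f : Cn (S n) f -> Cn n (Dy f).
Proof. intros H x y; apply (ex_diff_n_deriv_aux2 f n x y (H x y)). Qed.

Lemma smooth_Dx f : smooth f -> smooth (Dx f).
Proof. intros H n; apply Cn_Dx, H. Qed.

Lemma smooth_Dy f : smooth f -> smooth (Dy f).
Proof. intros H n; apply Cn_Dy, H. Qed.

Lemma Cn_continuity n f x y : Cn n f -> continuity_2d_pt f x y.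
Proof. intros H; specialize (H x y); destruct n; apply H. Qed.

Lemma Cn_derive_x n f x y :
  Cn (S n) f -> is_derive (fun t => f t y) x (Dx f x y).
Proof. intros H; apply Derive_correct, (H x y). Qed.

Lemma Cn_derive_y n f x y :
  Cn (S n) f -> is_derive (fun t => f x t) y (Dy f x y).
Proof. intros H; apply Derive_correct, (H x y). Qed.

Lemma Cn_differentiable n f x y :
  Cn (S n) f -> differentiable_pt_lim f x y (Dx f x y) (Dy f x y).
Proof.
intros H; apply filterdiff_differentiable_pt_lim.
apply (is_derive_filterdiff f x y (Dx f) (Dy f x y)).
- apply filter_forall; intros [u v]; apply (Cn_derive_x n), H.
- apply (Cn_derive_y n), H.
- apply (continuity_2d_pt_filterlim (Dx f)), (Cn_continuity n), Cn_Dx, H.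
Qed.

(** Class C^(n+1) from guessed partial derivatives [fx] and [fy]: the closure
    properties below are then inductions on [n] in which [Derive] is never
    computed. *)
Lemma Cn_intro n f fx fy :
  (forall x y, differentiable_pt_lim f x y (fx x y) (fy x y)) ->
  Cn n fx -> Cn n fy -> Cn (S n) f /\ Dx f = fx /\ Dy f = fy.
Proof.
intros Hf Hx Hy.
assert (Ex : Dx f = fx).
{ apply fun2_ext; intros x y.
  apply (differentiable_pt_lim_unique f x y _ _ (Hf x y)). }
assert (Ey : Dy f = fy).
{ apply fun2_ext; intros x y.
  apply (differentiable_pt_lim_unique f x y _ _ (Hf x y)). }
split; [|split; assumption].
intros x y; split; [|split; [|split; [|split]]].
- apply differentiable_continuity_pt; exists (fx x y), (fy x y); apply Hf.
- eexists; apply is_derive_Reals.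
  replace (fx x y) with (fx x y * 1 + fy x y * 0) by ring.
  eapply (derivable_pt_lim_comp_2d f (fun t => t) (fun _ => y));
    [apply Hf|apply derivable_pt_lim_id|apply derivable_pt_lim_const].
- eexists; apply is_derive_Reals.
  replace (fx x y) with (fx x y * 1 + fy x y * 0) by ring.
  eapply (derivable_pt_lim_comp_2d f (fun _ => x) (fun t => t));
    [apply Hf|apply derivable_pt_lim_const|apply derivable_pt_lim_id].
- change (ex_diff_n (Dx f) n x y); rewrite Ex; apply Hx.
- change (ex_diff_n (Dy f) n x y); rewrite Ey; apply Hy.
Qed.

Lemma Cn_0 f : (forall x y, continuity_2d_pt f x y) -> Cn 0 f.
Proof. intros H x y; split; [apply H|exact I]. Qed.

Lemma smooth_const c : smooth (fun _ _ => c).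
Proof.
intros n; revert c; induction n as [|n IH]; intros c.
  apply Cn_0; intros; apply continuity_2d_pt_const.
apply (Cn_intro n _ (fun _ _ => 0) (fun _ _ => 0)); auto.
intros x y; apply (differentiable_pt_lim_proj1_0 (fun _ => c)).
apply derivable_pt_lim_const.
Qed.

Lemma Dx_const c : Dx (fun _ _ => c) = fun _ _ => 0.
Proof. apply fun2_ext; intros x y; exact (Derive_const c x). Qed.

Lemma Dy_const c : Dy (fun _ _ => c) = fun _ _ => 0.
Proof. apply fun2_ext; intros x y; exact (Derive_const c y). Qed.

Lemma lin_differentiable a f b g x y fx fy gx gy :
  differentiable_pt_lim f x y fx fy -> differentiable_pt_lim g x y gx gy ->
  differentiable_pt_lim (lin a f b g) x y (a * fx + b * gx) (a * fy + b * gy).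
Proof.
intros Hf Hg.
apply (differentiable_pt_lim_comp (fun u v => a * u + b * v) f g); auto.
apply filterdiff_differentiable_pt_lim.
eapply filterdiff_ext_lin.
  apply (filterdiff_plus_fct (fun u : R * R => a * fst u)
    (fun u : R * R => b * snd u)).
    apply (filterdiff_scal_r_fct a (fun u : R * R => fst u)).
      intros; apply Rmult_comm.
    apply filterdiff_linear, is_linear_fst.
  apply (filterdiff_scal_r_fct b (fun u : R * R => snd u)).
    intros; apply Rmult_comm.
  apply filterdiff_linear, is_linear_snd.
intros [u v]; unfold plus, scal; simpl; unfold mult; simpl; ring.
Qed.

Lemma Cn_lin n a f b g : Cn n f -> Cn n g -> Cn n (lin a f b g).
Proof.
revert f g; induction n as [|n IH]; intros f g Hf Hg.
  apply Cn_0; intros x y; apply continuity_2d_pt_plus;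
    apply continuity_2d_pt_mult; try apply continuity_2d_pt_const;
    apply (Cn_continuity 0); assumption.
apply (Cn_intro n _ (lin a (Dx f) b (Dx g)) (lin a (Dy f) b (Dy g))).
- intros x y; apply lin_differentiable; apply (Cn_differentiable n); assumption.
- apply IH; apply Cn_Dx; assumption.
- apply IH; apply Cn_Dy; assumption.
Qed.

Lemma smooth_lin a f b g : smooth f -> smooth g -> smooth (lin a f b g).
Proof. intros Hf Hg n; apply Cn_lin; auto. Qed.

Lemma Dxy_lin n a f b g : Cn (S n) f -> Cn (S n) g ->
  Dx (lin a f b g) = lin a (Dx f) b (Dx g) /\
  Dy (lin a f b g) = lin a (Dy f) b (Dy g).
Proof.
intros Hf Hg.
assert (H : forall x y, Dx (lin a f b g) x y = lin a (Dx f) b (Dx g) x y /\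
  Dy (lin a f b g) x y = lin a (Dy f) b (Dy g) x y).
{ intros x y; apply (differentiable_pt_lim_unique (lin a f b g)).
  apply lin_differentiable; eapply Cn_differentiable; eassumption. }
split; apply fun2_ext; intros x y; apply H.
Qed.

Lemma Dx_lin n a f b g :
  Cn (S n) f -> Cn (S n) g -> Dx (lin a f b g) = lin a (Dx f) b (Dx g).
Proof. intros Hf Hg; apply (Dxy_lin n); assumption. Qed.

Lemma Dy_lin n a f b g :
  Cn (S n) f -> Cn (S n) g -> Dy (lin a f b g) = lin a (Dy f) b (Dy g).
Proof. intros Hf Hg; apply (Dxy_lin n); assumption. Qed.

Lemma Cn_mult n f g : Cn n f -> Cn n g -> Cn n (fun x y => f x y * g x y).
Proof.
revert f g; induction n as [|n IH]; intros f g Hf Hg.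
  apply Cn_0; intros x y; apply continuity_2d_pt_mult;
    apply (Cn_continuity 0); assumption.
assert (Hf' : Cn n f) by (apply (Cn_le (S n)); auto).
assert (Hg' : Cn n g) by (apply (Cn_le (S n)); auto).
apply (Cn_intro n _
  (lin 1 (fun x y => Dx f x y * g x y) 1 (fun x y => f x y * Dx g x y))
  (lin 1 (fun x y => Dy f x y * g x y) 1 (fun x y => f x y * Dy g x y))).
2, 3: apply Cn_lin; apply IH; auto using Cn_Dx, Cn_Dy.
intros x y; unfold lin.
replace (1 * _ + _) with (g x y * Dx f x y + f x y * Dx g x y) by ring.
replace (1 * _ + _) with (g x y * Dy f x y + f x y * Dy g x y) by ring.
apply (differentiable_pt_lim_comp (fun u v => u * v) f g);
  try (apply (Cn_differentiable n); assumption).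
apply filterdiff_differentiable_pt_lim.
eapply filterdiff_ext_lin.
  apply (filterdiff_mult_fct (fun u : R * R => fst u) (fun u => snd u)).
      intros; apply Rmult_comm.
    apply filterdiff_linear, is_linear_fst.
  apply filterdiff_linear, is_linear_snd.
intros [u v]; unfold plus, scal; simpl; unfold mult; simpl; ring.
Qed.

Lemma smooth_fst : smooth (fun x _ => x).
Proof.
intros [|n].
  apply Cn_0; intros; apply continuity_2d_pt_id1.
apply (Cn_intro n _ (fun _ _ => 1) (fun _ _ => 0)); try apply smooth_const.
intros x y; apply (differentiable_pt_lim_proj1_0 (fun t => t)).
apply derivable_pt_lim_id.
Qed.

Lemma smooth_snd : smooth (fun _ y => y).
Proof.
intros [|n].
  apply Cn_0; intros; apply continuity_2d_pt_id2.
apply (Cn_intro n _ (fun _ _ => 0) (fun _ _ => 1)); try apply smooth_const.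
intros x y; apply filterdiff_differentiable_pt_lim.
eapply filterdiff_ext_lin.
  apply (filterdiff_linear (fun u : R * R => snd u)), is_linear_snd.
assert (E : forall a b : R, b = a * 0 + b * 1) by (intros; ring).
intros [u v]; exact (E u v).
Qed.

Lemma smooth_mult f g :
  smooth f -> smooth g -> smooth (fun x y => f x y * g x y).
Proof. intros Hf Hg n; apply Cn_mult; auto. Qed.

Lemma smooth_plus f g :
  smooth f -> smooth g -> smooth (fun x y => f x y + g x y).
Proof.
intros Hf Hg; replace (fun x y => f x y + g x y) with (lin 1 f 1 g).
  apply smooth_lin; assumption.
apply fun2_ext; intros; unfold lin; ring.
Qed.

Lemma smooth_pow f k : smooth f -> smooth (fun x y => f x y ^ k).
Proof.
intros Hf; induction k as [|k IH]; [apply (smooth_const 1)|].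
apply (smooth_mult f _ Hf IH).
Qed.

Lemma smooth_sum (f : nat -> R -> R -> R) a b :
  (forall k, smooth (f k)) ->
  smooth (fun x y => sum_n_m (fun k => f k x y) a b).
Proof.
intros Hf; induction b as [|b IH].
- destruct a as [|a].
    replace (fun x y => _) with (f 0%nat); [apply Hf|].
    apply fun2_ext; intros; rewrite sum_n_n; reflexivity.
  replace (fun x y => _) with (fun _ _ : R => 0); [apply (smooth_const 0)|].
  apply fun2_ext; intros; rewrite sum_n_m_zero by lia; reflexivity.
- destruct (Nat.le_gt_cases a (S b)) as [H|H].
    replace (fun x y => sum_n_m (fun k => f k x y) a (S b))
      with (fun x y => sum_n_m (fun k => f k x y) a b + f (S b) x y).
      apply smooth_plus; auto.
    apply fun2_ext; intros; rewrite sum_n_Sm by lia; reflexivity.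
  replace (fun x y => _) with (fun _ _ : R => 0); [apply (smooth_const 0)|].
  apply fun2_ext; intros; rewrite sum_n_m_zero by lia; reflexivity.
Qed.

Lemma Dx_Dy_comm n f : Cn (S (S n)) f -> Dx (Dy f) = Dy (Dx f).
Proof.
intros H; apply fun2_ext; intros x y; apply (Schwarz f x y).
- exists (mkposreal 1 Rlt_0_1); intros u v _ _.
  split; [apply (H u v)|split; [apply (H u v)|split]].
    apply (Cn_Dy _ _ H u v).
  apply (Cn_Dx _ _ H u v).
- apply (Cn_continuity n), Cn_Dx, Cn_Dy, H.
- apply (Cn_continuity n), Cn_Dy, Cn_Dx, H.
Qed.

Lemma is_derive_line n f a b c d t : Cn (S n) f ->
  is_derive (fun s => f (a + s * b) (c + s * d)) t
    (b * Dx f (a + t * b) (c + t * d) + d * Dy f (a + t * b) (c + t * d)).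
Proof.
intros H; apply is_derive_Reals.
rewrite (Rmult_comm b), (Rmult_comm d).
apply (derivable_pt_lim_comp_2d f (fun s => a + s * b) (fun s => c + s * d)).
- apply (Cn_differentiable n), H.
- apply is_derive_Reals; auto_derive; [exact I|ring].
- apply is_derive_Reals; auto_derive; [exact I|ring].
Qed.

Lemma partial_derive_Sx a b f :
  partial_derive (S a) b f = Dx (partial_derive a b f).
Proof. reflexivity. Qed.

Lemma partial_derive_Dy a b f :
  partial_derive a b (Dy f) = partial_derive a (S b) f.
Proof.
apply fun2_ext; intros x y; unfold partial_derive; apply Derive_n_ext.
intros t; rewrite <- Nat.add_1_r, <- Derive_n_comp; reflexivity.
Qed.

Lemma partial_derive_Dx a b f : Cn (S b) f ->
  partial_derive a b (Dx f) = partial_derive (S a) b f.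
Proof.
intros Hf; revert f Hf; induction b as [|b IH]; intros f Hf.
- apply fun2_ext; intros x y.
  change (Derive_n (Derive (fun t => f t y)) a x
    = Derive_n (fun t => f t y) (S a) x).
  rewrite <- Nat.add_1_r, <- Derive_n_comp; reflexivity.
- rewrite <- !partial_derive_Dy, <- (Dx_Dy_comm b) by exact Hf.
  apply IH, Cn_Dy, Hf.
Qed.

Lemma partial_derive_const a b c :
  (1 <= a + b)%nat -> partial_derive a b (fun _ _ => c) = fun _ _ => 0.
Proof.
revert c; induction b as [|b IH]; intros c H.
  revert c; induction a as [|a IHa]; intros c; [lia|].
  rewrite <- partial_derive_Dx by apply smooth_const; rewrite Dx_const.
  destruct a as [|a]; [reflexivity|apply IHa; lia].
rewrite <- partial_derive_Dy, Dy_const.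
destruct (a + b)%nat eqn:E; [|apply IH; lia].
replace a with 0%nat by lia; replace b with 0%nat by lia; reflexivity.
Qed.

Lemma partial_derive_lin i j a f b g : Cn (i + j) f -> Cn (i + j) g ->
  partial_derive i j (lin a f b g)
  = lin a (partial_derive i j f) b (partial_derive i j g).
Proof.
revert f g; induction j as [|j IH]; intros f g Cf Cg.
- revert f g Cf Cg; induction i as [|i IHi]; intros f g Cf Cg; [reflexivity|].
  rewrite <- !partial_derive_Dx by (apply (Cn_le (S i + 0)); [lia|];
    try apply Cn_lin; assumption).
  rewrite (Dx_lin (i + 0)) by assumption; apply IHi; apply Cn_Dx; assumption.
- rewrite Nat.add_succ_r in Cf, Cg; rewrite <- !partial_derive_Dy.
  rewrite (Dy_lin (i + j)) by assumption; apply IH; apply Cn_Dy; assumption.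
Qed.

Lemma Cn_partial_derive n i j f :
  Cn (i + j + n) f -> Cn n (partial_derive i j f).
Proof.
intros Cf x y; replace n with (i + j + n - (i + j))%nat by lia.
apply ex_diff_n_deriv; [lia|apply Cf].
Qed.

Definition affine (p q c : R) : R -> R -> R := fun x y => p * x + q * y + c.

Lemma affine_differentiable p q c x y :
  differentiable_pt_lim (affine p q c) x y p q.
Proof.
apply (differentiable_pt_lim_ext (lin 1 (lin p (fun u _ => u) q (fun _ v => v))
  1 (fun _ _ => c))).
  exists (mkposreal 1 Rlt_0_1); intros u v _ _; unfold lin, affine; ring.
replace p with (1 * (p * 1 + q * 0) + 1 * 0) at 2 by ring.
replace q with (1 * (p * 0 + q * 1) + 1 * 0) at 3 by ring.
repeat apply lin_differentiable.
- apply (differentiable_pt_lim_proj1_0 (fun t => t)), derivable_pt_lim_id.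
- generalize (Cn_differentiable 0 _ x y (smooth_snd 1%nat)).
  replace (Dx (fun _ v : R => v) x y) with 0 by (symmetry; apply (Derive_const y x)).
  replace (Dy (fun _ v : R => v) x y) with 1 by (symmetry; apply (Derive_id y)).
  trivial.
- apply (differentiable_pt_lim_proj1_0 (fun _ => c)), derivable_pt_lim_const.
Qed.

Definition comp_affine (w : R -> R -> R) (p q c p' q' c' : R) : R -> R -> R :=
  fun x y => w (affine p q c x y) (affine p' q' c' x y).

Lemma comp_affine_differentiable n w p q c p' q' c' x y : Cn (S n) w ->
  differentiable_pt_lim (comp_affine w p q c p' q' c') x y
    (comp_affine (lin p (Dx w) p' (Dy w)) p q c p' q' c' x y)
    (comp_affine (lin q (Dx w) q' (Dy w)) p q c p' q' c' x y).
Proof.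
intros Hw; unfold comp_affine, lin.
rewrite (Rmult_comm p), (Rmult_comm p'), (Rmult_comm q), (Rmult_comm q').
apply differentiable_pt_lim_comp; try apply affine_differentiable.
apply (Cn_differentiable n), Hw.
Qed.

Lemma Cn_comp_affine n w p q c p' q' c' :
  Cn n w -> Cn n (comp_affine w p q c p' q' c').
Proof.
revert w; induction n as [|n IH]; intros w Hw.
  apply Cn_0; intros x y; apply continuity_2d_pt_filterlim.
  apply (continuous_comp_2 (fun z : R * R => affine p q c (fst z) (snd z))
    (fun z : R * R => affine p' q' c' (fst z) (snd z)) w).
  - apply (continuity_2d_pt_filterlim (affine p q c)).
    apply differentiable_continuity_pt; exists p, q; apply affine_differentiable.
  - apply (continuity_2d_pt_filterlim (affine p' q' c')).
    apply differentiable_continuity_pt; exists p', q'; apply affine_differentiable.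
  - apply (continuity_2d_pt_filterlim w), (Cn_continuity 0), Hw.
eapply (Cn_intro n).
- intros x y; apply (comp_affine_differentiable n), Hw.
- apply IH, Cn_lin; auto using Cn_Dx, Cn_Dy.
- apply IH, Cn_lin; auto using Cn_Dx, Cn_Dy.
Qed.

Lemma Dxy_comp_affine n w p q c p' q' c' : Cn (S n) w ->
  Dx (comp_affine w p q c p' q' c')
    = comp_affine (lin p (Dx w) p' (Dy w)) p q c p' q' c' /\
  Dy (comp_affine w p q c p' q' c')
    = comp_affine (lin q (Dx w) q' (Dy w)) p q c p' q' c'.
Proof.
intros Hw; eapply (Cn_intro n).
- intros x y; apply (comp_affine_differentiable n), Hw.
- apply Cn_comp_affine, Cn_lin; auto using Cn_Dx, Cn_Dy.
- apply Cn_comp_affine, Cn_lin; auto using Cn_Dx, Cn_Dy.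
Qed.

(** * Finite sums of real numbers *)

Lemma sum_n_m_Rplus (a b : nat -> R) n m :
  sum_n_m (fun k => a k + b k) n m = sum_n_m a n m + sum_n_m b n m.
Proof. apply (sum_n_m_plus a b). Qed.

Lemma sum_n_m_Rscal c (a : nat -> R) n m :
  sum_n_m (fun k => c * a k) n m = c * sum_n_m a n m.
Proof. apply (sum_n_m_mult_l (K := R_Ring) c a). Qed.

Lemma sum_n_m_Rext (a b : nat -> R) n m :
  (forall k, (n <= k <= m)%nat -> a k = b k) -> sum_n_m a n m = sum_n_m b n m.
Proof. apply (sum_n_m_ext_loc a b). Qed.

Lemma sum_n_m_R0 (a : nat -> R) n m :
  (forall k, (n <= k <= m)%nat -> a k = 0) -> sum_n_m a n m = 0.
Proof.
intros H; rewrite (sum_n_m_Rext a (fun _ => zero) n m H).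
apply (sum_n_m_const_zero (G := R_AbelianMonoid)).
Qed.

Lemma sum_n_m_1_n (a : nat -> R) n : a 0%nat = 0 -> sum_n_m a 1 n = sum_n a n.
Proof.
intros H; unfold sum_n; rewrite (sum_Sn_m a 0 n) by lia; rewrite H.
symmetry; apply (Rplus_0_l (sum_n_m a 1 n)).
Qed.

Lemma sum_n_m_Rle (a b : nat -> R) n m :
  (forall k, (n <= k <= m)%nat -> a k <= b k) ->
  sum_n_m a n m <= sum_n_m b n m.
Proof.
intros H; destruct (Nat.le_gt_cases n m) as [Hnm|Hnm].
2: rewrite !sum_n_m_zero by lia; apply Rle_refl.
induction m as [|m IH].
  replace n with 0%nat in * by lia; rewrite !sum_n_n; apply H; lia.
destruct (Nat.eq_dec n (S m)) as [->|Hn].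
  rewrite !sum_n_n; apply H; lia.
rewrite !sum_n_Sm by lia; apply Rplus_le_compat; [|apply H; lia].
apply IH; [|lia]; intros k Hk; apply H; lia.
Qed.

(** * Expansion of a polynomial in Bernoulli polynomials *)

Lemma S_poly_0 j : S_poly j 0 = 0.
Proof. unfold S_poly; ring. Qed.

Lemma S_poly_O t : S_poly 0 t = 0.
Proof. unfold S_poly; rewrite !bernoulli_0; ring. Qed.

Lemma is_derive_S_poly j t :
  is_derive (S_poly (S j)) t (INR (S j) * (S_poly j t + bernoulli j 0)).
Proof.
unfold S_poly at 1.
replace (INR (S j) * _) with (minus (INR (S j) * bernoulli j t) 0)
  by (unfold S_poly, minus, plus, opp; simpl; ring).
apply (is_derive_minus (bernoulli (S j)) (fun _ => bernoulli (S j) 0)).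
  apply bernoulli_derive.
apply (is_derive_const (K := R_AbsRing) (V := R_NormedModule)).
Qed.

Lemma derive_const_line (f : R -> R) c :
  (forall t, is_derive f t c) -> forall t, f t = f 0 + c * t.
Proof.
intros H t.
destruct (MVT_gen f 0 t (fun _ => c)) as [s [_ E]].
- intros; apply H.
- intros s _; apply derivable_continuous_pt; exists c; apply is_derive_Reals, H.
- lra.
Qed.

Lemma S_poly_1_t t : S_poly 1 t = t.
Proof.
rewrite (derive_const_line (S_poly 1) 1).
  rewrite S_poly_0; ring.
intros s; generalize (is_derive_S_poly 0 s).
rewrite S_poly_O, bernoulli_0; replace (INR 1 * (0 + 1)) with 1; [trivial|simpl; ring].
Qed.

(** [B_(j+1)] has integral 0 over [0, 1]. *)
Lemma S_poly_1 j : S_poly (S (S j)) 1 = 0.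
Proof.
assert (H : is_RInt (bernoulli (S j)) 0 1
  (minus (S_poly (S (S j)) 1 / INR (S (S j))) (S_poly (S (S j)) 0 / INR (S (S j))))).
{ apply (is_RInt_derive (V := R_CompleteNormedModule)
    (fun t => S_poly (S (S j)) t / INR (S (S j)))).
  - intros t _.
    replace (bernoulli (S j) t)
      with (/ INR (S (S j)) * (INR (S (S j)) * bernoulli (S j) t))
      by (field; apply not_0_INR; lia).
    apply is_derive_ext with (fun t => / INR (S (S j)) * S_poly (S (S j)) t).
      intros s; apply Rmult_comm.
    apply (is_derive_scal (S_poly (S (S j)))).
    replace (bernoulli (S j) t) with (S_poly (S j) t + bernoulli (S j) 0)
      by (unfold S_poly; ring).
    apply is_derive_S_poly.
  - intros t _; apply (ex_derive_continuous (K := R_AbsRing) (V := R_NormedModule)).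
    eexists; apply bernoulli_derive. }
rewrite S_poly_0 in H.
generalize (is_RInt_unique _ _ _ _ H); rewrite (is_RInt_unique _ _ _ _ (bernoulli_int j)).
assert (N : INR (S (S j)) <> 0) by (apply not_0_INR; lia).
set (k := INR (S (S j))) in *; intros E.
change (0 = S_poly (S (S j)) 1 / k + - (0 / k)) in E.
apply (Rmult_eq_reg_r (/ k)); [|apply Rinv_neq_0_compat, N].
unfold Rdiv in E; lra.
Qed.

(** Both sides have the same value at 0 and at 1, since [S_j] vanishes there
    for [j >= 2], and by induction on the degree their derivatives differ by a
    constant.  The derivatives form a chain [h 0, h 1, ...] rather than iterated
    [Derive]s, so that the lemma applies directly to directional derivatives
    along a segment. *)
Lemma bernoulli_expansion n (h : nat -> R -> R) :
  (forall k t, is_derive (h k) t (h (S k) t)) ->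
  (forall t, h (S n) t = 0) ->
  forall t, h 0%nat t = h 0%nat 0
    + sum_n_m (fun j => (h (j - 1)%nat 1 - h (j - 1)%nat 0)
                        * (S_poly j t / INR (fact j))) 1 n.
Proof.
revert h; induction n as [|n IH]; intros h Hd Hn t.
  rewrite sum_n_m_zero by lia; unfold zero; simpl.
  rewrite (derive_const_line (h 0%nat) 0).
    ring.
  intros s; rewrite <- (Hn s); apply Hd.
set (d := fun k => h k 1 - h k 0).
set (e := fun t => h 0%nat t
  - sum_n (fun j => d j * (S_poly (S j) t / INR (fact (S j)))) n).
assert (Hsum : sum_n_m (fun j => (h (j - 1)%nat 1 - h (j - 1)%nat 0)
    * (S_poly j t / INR (fact j))) 1 (S n)
  = sum_n (fun j => d j * (S_poly (S j) t / INR (fact (S j)))) n).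
{ unfold sum_n; rewrite <- sum_n_m_S.
  apply sum_n_m_ext; intros j; unfold d; simpl (S j - 1)%nat.
  rewrite Nat.sub_0_r; reflexivity. }
rewrite Hsum; clear Hsum.
(* [e'] is the constant [c]: by induction the sum in [h 1 s] cancels the
   [S_poly j s], and [bernoulli j s = S_poly j s + bernoulli j 0] *)
set (c := h 1%nat 0 - sum_n (fun j => d j * (bernoulli j 0 / INR (fact j))) n).
assert (He : forall s, is_derive e s c).
{ intros s.
  assert (K : h 1%nat s - sum_n
    (fun j => d j * ((S_poly j s + bernoulli j 0) / INR (fact j))) n = c).
  { rewrite (IH (fun k => h (S k))) by auto.
    rewrite sum_n_m_1_n by (rewrite S_poly_O; unfold Rdiv; ring).
    unfold c, sum_n.
    rewrite (sum_n_m_Rext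
      (fun j => d j * ((S_poly j s + bernoulli j 0) / INR (fact j)))
      (fun j => (h (S (j - 1)) 1 - h (S (j - 1)) 0)
                * (S_poly j s / INR (fact j))
                + d j * (bernoulli j 0 / INR (fact j)))).
      rewrite sum_n_m_Rplus; ring.
    intros [|j] _; unfold d.
      rewrite S_poly_O; unfold Rdiv; ring.
    replace (S (S j - 1)) with (S j) by lia; unfold Rdiv; ring. }
  rewrite <- K.
  apply (is_derive_minus (h 0%nat)); [apply Hd|].
  apply (is_derive_sum_n (K := R_AbsRing) (V := R_NormedModule)
    (fun j s => d j * (S_poly (S j) s / INR (fact (S j))))).
  intros j _.
  apply (is_derive_scal (fun s => S_poly (S j) s / INR (fact (S j)))).
  replace ((S_poly j s + bernoulli j 0) / INR (fact j))
    with (/ INR (fact (S j)) * (INR (S j) * (S_poly j s + bernoulli j 0))).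
    apply is_derive_ext with (fun s => / INR (fact (S j)) * S_poly (S j) s).
      intros; apply Rmult_comm.
    apply (is_derive_scal (S_poly (S j))), is_derive_S_poly.
  rewrite fact_simpl, mult_INR; field.
  split; [apply INR_fact_neq_0|apply not_0_INR; lia]. }
assert (E := derive_const_line e c He).
assert (E0 : e 0 = h 0%nat 0).
{ unfold e, sum_n; rewrite sum_n_m_R0; [ring|].
  intros j _; rewrite S_poly_0; unfold Rdiv; ring. }
assert (E1 : e 1 = h 0%nat 0).
{ unfold e, sum_n; rewrite sum_Sn_m by lia.
  rewrite (sum_n_m_R0 _ 1 n).
    rewrite S_poly_1_t; unfold d, plus; simpl; field.
  intros [|j] Hj; [lia|].
  rewrite S_poly_1; unfold Rdiv; ring. }
generalize (E t) (E 1); rewrite E1, E0; intros Et Ec.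
unfold e in Et; nra.
Qed.

(** * Directional derivatives and polynomials of two variables *)

Lemma Ddir_lin P Q f :
  Ddir P Q f = lin (fst P - fst Q) (Dx f) (snd P - snd Q) (Dy f).
Proof. reflexivity. Qed.

Lemma Cn_Ddir n P Q f : Cn (S n) f -> Cn n (Ddir P Q f).
Proof. intros H; apply Cn_lin; [apply Cn_Dx|apply Cn_Dy]; exact H. Qed.

Lemma Cn_Dpow n k P Q f : Cn (k + n) f -> Cn n (Dpow P Q k f).
Proof.
revert n; induction k as [|k IH]; intros n H; [exact H|].
apply Cn_Ddir, IH; rewrite Nat.add_succ_r; exact H.
Qed.

Lemma smooth_Dpow P Q k f : smooth f -> smooth (Dpow P Q k f).
Proof. intros H n; apply Cn_Dpow, H. Qed.

(** [Ddir] depends linearly on the difference of its two points.  This covers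
    both the reversal of an edge ([c = -1]) and its rescaling. *)
Lemma Dpow_scal_dir c P Q P' Q' k f :
  fst P - fst Q = c * (fst P' - fst Q') ->
  snd P - snd Q = c * (snd P' - snd Q') ->
  Dpow P Q k f = fun x y => c ^ k * Dpow P' Q' k f x y.
Proof.
intros H1 H2; induction k as [|k IH].
  apply fun2_ext; intros; simpl; ring.
change (Dpow P Q (S k) f) with (Ddir P Q (Dpow P Q k f)); rewrite IH.
apply fun2_ext; intros x y; unfold Ddir.
rewrite (Derive_scal (fun t => Dpow P' Q' k f t y)).
rewrite (Derive_scal (fun t => Dpow P' Q' k f x t)).
change (Dpow P' Q' (S k) f) with (Ddir P' Q' (Dpow P' Q' k f)); unfold Ddir.
rewrite H1, H2; simpl; ring.
Qed.

Lemma Dpow_scal P Q k c f :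
  Dpow P Q k (fun x y => c * f x y) = fun x y => c * Dpow P Q k f x y.
Proof.
induction k as [|k IH]; [reflexivity|].
change (Dpow P Q (S k) (fun x y => c * f x y))
  with (Ddir P Q (Dpow P Q k (fun x y => c * f x y))); rewrite IH.
change (Dpow P Q (S k) f) with (Ddir P Q (Dpow P Q k f)).
apply fun2_ext; intros x y; unfold Ddir.
rewrite (Derive_scal (fun t => Dpow P Q k f t y)).
rewrite (Derive_scal (fun t => Dpow P Q k f x t)); ring.
Qed.

(** For a smooth function: to be a polynomial of degree less than [n]. *)
Fixpoint poly_lt (n : nat) (f : R -> R -> R) : Prop :=
  match n with
  | O => forall x y, f x y = 0
  | S p => poly_lt p (Dx f) /\ poly_lt p (Dy f)
  end.

Lemma poly_lt_lin n a f b g : smooth f -> smooth g ->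
  poly_lt n f -> poly_lt n g -> poly_lt n (lin a f b g).
Proof.
revert f g; induction n as [|n IH]; intros f g Sf Sg Hf Hg.
  intros x y; unfold lin; rewrite Hf, Hg; ring.
destruct Hf, Hg; split.
  rewrite (Dx_lin 0) by auto; apply IH; auto using smooth_Dx.
rewrite (Dy_lin 0) by auto; apply IH; auto using smooth_Dy.
Qed.

Lemma pow_neg1_sqr n : (-1) ^ n * (-1) ^ n = 1.
Proof. rewrite <- Rpow_mult_distr; replace (-1 * -1) with 1 by ring; apply pow1. Qed.

Lemma poly_lt_Dpow n P Q k f :
  smooth f -> poly_lt (k + n) f -> poly_lt n (Dpow P Q k f).
Proof.
intros Sf; revert n; induction k as [|k IH]; intros n H; [exact H|].
specialize (IH (S n)); rewrite Nat.add_succ_r in IH; destruct (IH H).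
assert (Sk : smooth (Dpow P Q k f)) by (apply smooth_Dpow, Sf).
apply (poly_lt_lin n _ (Dx (Dpow P Q k f)) _ (Dy (Dpow P Q k f)));
  auto using smooth_Dx, smooth_Dy.
Qed.

Definition on_line (f : R -> R -> R) (P Q : R * R) (t : R) : R :=
  f (fst P + t * (fst Q - fst P)) (snd P + t * (snd Q - snd P)).

Lemma on_line_0 f P Q : on_line f P Q 0 = f (fst P) (snd P).
Proof. unfold on_line; f_equal; ring. Qed.

Lemma on_line_1 f P Q : on_line f P Q 1 = f (fst Q) (snd Q).
Proof. unfold on_line; f_equal; ring. Qed.

Lemma is_derive_on_line n f P Q t : Cn (S n) f ->
  is_derive (on_line f P Q) t (on_line (Ddir Q P f) P Q t).
Proof. apply (is_derive_line n f). Qed.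

Lemma segment_expansion n f P Q t : smooth f -> poly_lt (S n) f ->
  on_line f P Q t = f (fst P) (snd P)
    + sum_n_m (fun j => (Dpow Q P (j - 1) f (fst Q) (snd Q)
                         - Dpow Q P (j - 1) f (fst P) (snd P))
                        * (S_poly j t / INR (fact j))) 1 n.
Proof.
intros Sf Hf.
rewrite (bernoulli_expansion n (fun k => on_line (Dpow Q P k f) P Q)).
- rewrite on_line_0; f_equal.
  apply sum_n_m_Rext; intros j _; rewrite on_line_0, on_line_1; reflexivity.
- intros k s; apply (is_derive_on_line 0), smooth_Dpow, Sf.
- intros s; apply (poly_lt_Dpow 0 Q P (S n)); [exact Sf|].
  rewrite Nat.add_0_r; exact Hf.
Qed.

(** * Reproduction of polynomials by the generalized Taylor polynomial *)

(** The shape common to all the polynomials [gen_taylor]: linear in the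
    differences [d], [e] of derivatives at the vertices, with coefficients
    depending only on [u = lambda2 + lambda3] and [v = lambda2]. *)
Definition taylor_form (m : nat) (d : nat -> R) (e : nat -> nat -> R)
    (u v : R) : R :=
  sum_n_m (fun j => d j * (S_poly j u / INR (fact j))) 1 m
  + sum_n_m (fun i => sum_n_m (fun j => e i j
        * (S_prod i j u v / (INR (fact i) * INR (fact j))))
      1 (m - i + 1)) 1 m.

Definition edge_diff (V1 V2 V3 : R * R) (f : R -> R -> R) (j : nat) : R :=
  Dtri V1 V2 V3 (0, j - 1)%nat f V3 - Dtri V1 V2 V3 (0, j - 1)%nat f V1.

Definition face_diff (V1 V2 V3 : R * R) (f : R -> R -> R) (i j : nat) : R :=
  (-1) ^ (i + j) * (Dtri V2 V1 V3 (j - 1, i - 1)%nat f V2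
                    - Dtri V2 V1 V3 (j - 1, i - 1)%nat f V1)
  + (-1) ^ j * (Dtri V3 V1 V2 (j - 1, i - 1)%nat f V3
                - Dtri V3 V1 V2 (j - 1, i - 1)%nat f V1).

Lemma gen_taylor_form m V1 V2 V3 f x y :
  let l2 := lambda2 V1 V2 V3 (x, y) in
  let l3 := lambda3 V1 V2 V3 (x, y) in
  gen_taylor m V1 V2 V3 f x y = f (fst V1) (snd V1)
    + taylor_form m (edge_diff V1 V2 V3 f) (face_diff V1 V2 V3 f) (l2 + l3) l2.
Proof. unfold gen_taylor, taylor_form; rewrite <- Rplus_assoc; reflexivity. Qed.

Lemma barycentric_eq V1 V2 V3 x y : A V1 V2 V3 <> 0 ->
  let l2 := lambda2 V1 V2 V3 (x, y) in
  let l3 := lambda3 V1 V2 V3 (x, y) in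
  x = fst V1 + l2 * (fst V2 - fst V1) + l3 * (fst V3 - fst V1) /\
  y = snd V1 + l2 * (snd V2 - snd V1) + l3 * (snd V3 - snd V1).
Proof.
intros H; unfold lambda2, lambda3; simpl.
destruct V1, V2, V3; unfold A in *; simpl in *; split; field; exact H.
Qed.

(** [P] on the line V1 V3 and [Q] on the line V1 V2 are the points where
    [lambda2 + lambda3 = u]; their line is parallel to V2 V3.  The function is
    expanded along it; the values at [P] and [Q] of its derivatives along V2 - V3
    are then expanded along the two edges, where their constant terms, both at
    V1, cancel. *)
Lemma gen_taylor_reproduces_off m V1 V2 V3 f x y :
  A V1 V2 V3 <> 0 -> smooth f -> poly_lt (S m) f ->
  lambda2 V1 V2 V3 (x, y) + lambda3 V1 V2 V3 (x, y) <> 0 ->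
  gen_taylor m V1 V2 V3 f x y = f x y.
Proof.
intros HA Sf Hf Hu; rewrite gen_taylor_form.
destruct (barycentric_eq V1 V2 V3 x y HA) as [Ex Ey]; cbv zeta in *.
set (l2 := lambda2 V1 V2 V3 (x, y)) in *.
set (l3 := lambda3 V1 V2 V3 (x, y)) in *.
set (u := l2 + l3) in *.
set (P := (fst V1 + u * (fst V3 - fst V1), snd V1 + u * (snd V3 - snd V1))).
set (Q := (fst V1 + u * (fst V2 - fst V1), snd V1 + u * (snd V2 - snd V1))).
assert (E : f x y = on_line f P Q (l2 / u)).
{ rewrite Ex, Ey; unfold on_line, P, Q; simpl; f_equal; unfold u; field; exact Hu. }
rewrite E, (segment_expansion m f P Q) by assumption; clear E.
(* [f P] gives the terms of [edge_diff] *)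
change (f (fst P) (snd P)) with (on_line f V1 V3 u).
rewrite (segment_expansion m f V1 V3) by assumption.
unfold taylor_form; rewrite Rplus_assoc; f_equal; f_equal.
apply sum_n_m_Rext; intros i Hi.
set (q := Dpow V2 V3 (i - 1) f).
assert (Sq : smooth q) by (apply smooth_Dpow, Sf).
assert (Hq : poly_lt (S (m - i + 1)) q).
{ apply poly_lt_Dpow; [exact Sf|].
  replace (i - 1 + S (m - i + 1))%nat with (S m) by lia; exact Hf. }
(* the power of [u] in front of [S_i] comes from [Q - P = u (V2 - V3)] *)
rewrite (Dpow_scal_dir u Q P V2 V3) by (unfold P, Q; simpl; ring).
change (Dpow V2 V3 (i - 1) f) with q; cbv beta.
change (q (fst Q) (snd Q)) with (on_line q V1 V2 u).
change (q (fst P) (snd P)) with (on_line q V1 V3 u).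
rewrite !(segment_expansion (m - i + 1) q) by assumption.
transitivity (u ^ (i - 1) * (S_poly i (l2 / u) / INR (fact i))
  * sum_n_m (fun j => (Dpow V2 V1 (j - 1) q (fst V2) (snd V2)
                       - Dpow V2 V1 (j - 1) q (fst V1) (snd V1))
                      * (S_poly j u / INR (fact j))
     + -1 * ((Dpow V3 V1 (j - 1) q (fst V3) (snd V3)
              - Dpow V3 V1 (j - 1) q (fst V1) (snd V1))
              * (S_poly j u / INR (fact j)))) 1 (m - i + 1)).
2: rewrite sum_n_m_Rplus, sum_n_m_Rscal; ring.
rewrite <- sum_n_m_Rscal; apply sum_n_m_Rext; intros j Hj.
rewrite S_prodE by (assumption || lia).
destruct i as [|i]; [lia|]; destruct j as [|j]; [lia|].
unfold face_diff, Dtri; cbn [fst snd]; simpl (S _ - 1)%nat in *.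
rewrite !Nat.sub_0_r in *.
(* [face_diff] uses the reversed edges; its signs undo the reversals *)
rewrite (Dpow_scal_dir (-1) V3 V2 V2 V3) by ring.
replace (Dpow V2 V3 i f) with q
  by (unfold q; simpl; rewrite Nat.sub_0_r; reflexivity).
rewrite Dpow_scal.
rewrite (Dpow_scal_dir (-1) V1 V2 V2 V1), (Dpow_scal_dir (-1) V1 V3 V3 V1) by ring.
rewrite pow_add; cbv beta; rewrite <- !tech_pow_Rmult.
generalize (pow_neg1_sqr i) (pow_neg1_sqr j).
generalize ((-1) ^ i) ((-1) ^ j); intros s t Hs Ht.
set (a2 := Dpow V2 V1 j q _ _); set (b2 := Dpow V2 V1 j q _ _).
set (a3 := Dpow V3 V1 j q _ _); set (b3 := Dpow V3 V1 j q _ _).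
replace (-1 * s * (-1 * t) * _ + _)
  with ((s * s) * (t * t) * (a2 - b2) - (t * t) * (a3 - b3)) by ring.
rewrite Hs, Ht; field; split; apply INR_fact_neq_0.
Qed.

Lemma smooth_S_poly j : smooth (fun u _ => S_poly j u).
Proof.
replace (fun u _ => S_poly j u)
  with (fun u _ : R => sum_n_m (fun l => bernoulli_coef j l * u ^ l) 1 j)
  by (apply fun2_ext; intros; symmetry; apply S_poly_sum).
apply (smooth_sum (fun l u _ => bernoulli_coef j l * u ^ l)); intros l.
apply (smooth_mult (fun _ _ => bernoulli_coef j l)); [apply smooth_const|].
apply (smooth_pow (fun u _ => u)), smooth_fst.
Qed.

Lemma smooth_S_prod i j : smooth (S_prod i j).
Proof.
apply smooth_mult.
- apply (smooth_sum (fun k u v => bernoulli_coef i k * v ^ k * u ^ (i - k))).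
  intros k; apply (smooth_mult (fun _ v => bernoulli_coef i k * v ^ k)).
    apply (smooth_mult (fun _ _ => bernoulli_coef i k)); [apply smooth_const|].
    apply (smooth_pow (fun _ v => v)), smooth_snd.
  apply (smooth_pow (fun u _ => u)), smooth_fst.
- apply (smooth_sum (fun l u _ => bernoulli_coef j l * u ^ (l - 1))).
  intros l; apply (smooth_mult (fun _ _ => bernoulli_coef j l));
    [apply smooth_const|].
  apply (smooth_pow (fun u _ => u)), smooth_fst.
Qed.

Lemma smooth_taylor_form m d e : smooth (taylor_form m d e).
Proof.
apply smooth_plus.
- apply (smooth_sum (fun j u _ => d j * (S_poly j u / INR (fact j)))).
  intros j; apply (smooth_mult (fun _ _ => d j)); [apply smooth_const|].
  apply smooth_mult; [apply smooth_S_poly|apply smooth_const].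
- apply (smooth_sum (fun i u v => sum_n_m (fun j => e i j
    * (S_prod i j u v / (INR (fact i) * INR (fact j)))) 1 (m - i + 1))).
  intros i; apply (smooth_sum (fun j u v => e i j
    * (S_prod i j u v / (INR (fact i) * INR (fact j))))).
  intros j; apply (smooth_mult (fun _ _ => e i j)); [apply smooth_const|].
  apply smooth_mult; [apply smooth_S_prod|apply smooth_const].
Qed.

Definition at_barycentric (w : R -> R -> R) (V1 V2 V3 : R * R) : R -> R -> R :=
  fun x y => w (lambda2 V1 V2 V3 (x, y) + lambda3 V1 V2 V3 (x, y))
               (lambda2 V1 V2 V3 (x, y)).

(** The linear coefficients are edges of the triangle divided by [A V1 V2 V3],
    and the constant ones make both functions vanish at [V1]. *)
Lemma at_barycentric_affine w V1 V2 V3 : A V1 V2 V3 <> 0 ->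
  at_barycentric w V1 V2 V3 = comp_affine w
    ((snd V3 - snd V2) / A V1 V2 V3) ((fst V2 - fst V3) / A V1 V2 V3)
    (((fst V3 - fst V2) * snd V1 - (snd V3 - snd V2) * fst V1) / A V1 V2 V3)
    ((snd V3 - snd V1) / A V1 V2 V3) ((fst V1 - fst V3) / A V1 V2 V3)
    (((fst V3 - fst V1) * snd V1 - (snd V3 - snd V1) * fst V1) / A V1 V2 V3).
Proof.
intros HA; apply fun2_ext; intros x y; unfold at_barycentric, comp_affine, affine.
unfold lambda2, lambda3; simpl; destruct V1, V2, V3; unfold A in *; simpl in *.
f_equal; field; exact HA.
Qed.

Lemma gen_taylor_at_barycentric m V1 V2 V3 f :
  gen_taylor m V1 V2 V3 f = lin 1 (fun _ _ => f (fst V1) (snd V1))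
    1 (at_barycentric (taylor_form m (edge_diff V1 V2 V3 f) (face_diff V1 V2 V3 f))
         V1 V2 V3).
Proof.
apply fun2_ext; intros x y; rewrite gen_taylor_form.
unfold lin, at_barycentric; ring.
Qed.

Lemma smooth_at_barycentric w V1 V2 V3 : A V1 V2 V3 <> 0 -> smooth w ->
  smooth (at_barycentric w V1 V2 V3).
Proof. intros HA Sw n; rewrite at_barycentric_affine by exact HA; apply Cn_comp_affine, Sw. Qed.

Lemma smooth_gen_taylor m V1 V2 V3 f : A V1 V2 V3 <> 0 ->
  smooth (gen_taylor m V1 V2 V3 f).
Proof.
intros HA; rewrite gen_taylor_at_barycentric.
apply smooth_lin; [apply smooth_const|].
apply smooth_at_barycentric; [exact HA|apply smooth_taylor_form].
Qed.

Lemma continuous_eq_0 (g : R -> R) :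
  continuous g 0 -> (forall t, 0 < t <= 1 -> g t = 0) -> g 0 = 0.
Proof.
intros Hc H; destruct (Req_dec (g 0) 0) as [E|E]; [exact E|exfalso].
destruct (proj1 (filterlim_locally g (g 0)) Hc
  (mkposreal (Rabs (g 0)) (Rabs_pos_lt _ E))) as [d Hd].
assert (Ht : 0 < Rmin 1 (d / 2) <= 1).
{ split; [apply Rmin_pos; generalize (cond_pos d); lra|apply Rmin_l]. }
assert (B : Rabs (g (Rmin 1 (d / 2)) - g 0) < Rabs (g 0)).
{ apply Hd; change (Rabs (Rmin 1 (d / 2) - 0) < d).
  rewrite Rminus_0_r, Rabs_pos_eq by lra.
  generalize (Rmin_r 1 (d / 2)) (cond_pos d); lra. }
rewrite H, Rminus_0_l, Rabs_Ropp in B by exact Ht; lra.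
Qed.

(** The line [lambda2 + lambda3 = 0], where the expansion above does not make
    sense, is reached by continuity. *)
Lemma gen_taylor_reproduces m V1 V2 V3 f :
  A V1 V2 V3 <> 0 -> smooth f -> poly_lt (S m) f ->
  gen_taylor m V1 V2 V3 f = f.
Proof.
intros HA Sf Hf; apply fun2_ext; intros x y.
destruct (Req_dec (lambda2 V1 V2 V3 (x, y) + lambda3 V1 V2 V3 (x, y)) 0) as [E|E].
2: apply gen_taylor_reproduces_off; assumption.
set (g := lin 1 (gen_taylor m V1 V2 V3 f) (-1) f).
assert (Sg : smooth g) by (apply smooth_lin; [apply smooth_gen_taylor|]; assumption).
(* moving along V2 - V1 changes the value of [lambda2 + lambda3] *)
assert (G : g (x + 0 * (fst V2 - fst V1)) (y + 0 * (snd V2 - snd V1)) = 0).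
{ apply (continuous_eq_0
    (fun t => g (x + t * (fst V2 - fst V1)) (y + t * (snd V2 - snd V1)))).
  - apply (ex_derive_continuous (K := R_AbsRing) (V := R_NormedModule)).
    eexists; apply (is_derive_line 0), Sg.
  - intros t [Ht _]; unfold g, lin; rewrite gen_taylor_reproduces_off; try assumption.
      ring.
    replace (_ + _) with (lambda2 V1 V2 V3 (x, y) + lambda3 V1 V2 V3 (x, y) + t).
      rewrite E; lra.
    unfold lambda2, lambda3; destruct V1, V2, V3; unfold A in *; simpl in *.
    field; exact HA. }
rewrite !Rmult_0_l, !Rplus_0_r in G; unfold g, lin in G; lra.
Qed.

(** * Taylor polynomials in two variables *)

Definition power_term (z : R) (k : nat) : R := z ^ k / INR (fact k).

Lemma is_derive_power_term (z0 : R) (k : nat) (z : R) :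
  is_derive (fun t => power_term (t - z0) (S k)) z (power_term (z - z0) k).
Proof.
apply is_derive_ext with (fun t => / INR (fact (S k)) * (t - z0) ^ S k).
  intros t; apply Rmult_comm.
replace (power_term (z - z0) k)
  with (1 * (/ INR (fact (S k)) * INR (S k) * (z - z0) ^ k)).
  apply (is_derive_comp (fun s => / INR (fact (S k)) * s ^ S k) (fun t => t - z0)).
    apply is_derive_monomial.
  auto_derive; [exact I|ring].
unfold power_term; rewrite fact_simpl, mult_INR; field.
split; [apply INR_fact_neq_0|apply not_0_INR; lia].
Qed.

(** The homogeneous part of degree [n] of the polynomial whose partial
    derivatives at [V] are the [c a b]. *)
Definition homog (n : nat) (c : nat -> nat -> R) (V : R * R) : R -> R -> R :=
  fun x y => sum_n_m (fun a => c a (n - a)%nat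
    * (power_term (x - fst V) a * power_term (y - snd V) (n - a))) 0 n.

(** Indexed by arbitrary coefficients [c], so that differentiation is exactly
    a shift of indices. *)
Fixpoint taylor_poly (n : nat) (c : nat -> nat -> R) (V : R * R) :
  R -> R -> R :=
  match n with
  | O => homog 0 c V
  | S p => lin 1 (taylor_poly p c V) 1 (homog (S p) c V)
  end.

Definition shift_x (c : nat -> nat -> R) : nat -> nat -> R := fun a b => c (S a) b.
Definition shift_y (c : nat -> nat -> R) : nat -> nat -> R := fun a b => c a (S b).

Lemma smooth_power_term_x z0 k : smooth (fun x _ => power_term (x - z0) k).
Proof.
apply smooth_mult; [|apply smooth_const].
apply (smooth_pow (fun x _ => x - z0)).
apply (smooth_plus (fun x _ => x)); [apply smooth_fst|apply smooth_const].
Qed.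

Lemma smooth_power_term_y z0 k : smooth (fun _ y => power_term (y - z0) k).
Proof.
apply (smooth_mult (fun _ y => (y - z0) ^ k)); [|apply smooth_const].
apply (smooth_pow (fun _ y => y - z0)).
apply (smooth_plus (fun _ y => y)); [apply smooth_snd|apply smooth_const].
Qed.

Lemma smooth_homog n c V : smooth (homog n c V).
Proof.
apply (smooth_sum (fun a x y => c a (n - a)%nat
    * (power_term (x - fst V) a * power_term (y - snd V) (n - a)))); intros a.
apply (smooth_mult (fun _ _ => c a (n - a)%nat)); [apply smooth_const|].
apply (smooth_mult (fun x _ => power_term (x - fst V) a)
  (fun _ y => power_term (y - snd V) (n - a))).
  apply smooth_power_term_x.
apply smooth_power_term_y.
Qed.

Lemma smooth_taylor_poly n c V : smooth (taylor_poly n c V).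
Proof.
induction n as [|n IH]; [apply smooth_homog|].
apply smooth_lin; [exact IH|apply smooth_homog].
Qed.

Lemma homog_O c V : homog 0 c V = fun _ _ => c 0%nat 0%nat.
Proof.
apply fun2_ext; intros; unfold homog; rewrite sum_n_n.
unfold power_term; simpl; field.
Qed.

Lemma Dx_homog n c V : Dx (homog (S n) c V) = homog n (shift_x c) V.
Proof.
apply fun2_ext; intros x y; apply is_derive_unique.
apply is_derive_ext with (fun t => c 0%nat (S n) * power_term (y - snd V) (S n)
  + sum_n (fun a => c (S a) (n - a)%nat
      * (power_term (t - fst V) (S a) * power_term (y - snd V) (n - a))) n).
  intros t; unfold homog, sum_n.
  rewrite (sum_Sn_m _ 0 (S n)) by lia; rewrite <- sum_n_m_S.
  apply Rplus_eq_compat_r; unfold power_term; simpl; field.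
  apply (INR_fact_neq_0 (S n)).
rewrite <- (Rplus_0_l (homog n (shift_x c) V x y)).
apply (is_derive_plus (fun _ : R => c 0%nat (S n) * power_term (y - snd V) (S n))).
  apply (is_derive_const (K := R_AbsRing) (V := R_NormedModule)).
apply (is_derive_sum_n (K := R_AbsRing) (V := R_NormedModule)
  (fun a t => c (S a) (n - a)%nat
      * (power_term (t - fst V) (S a) * power_term (y - snd V) (n - a)))).
intros a _; unfold shift_x.
apply (is_derive_scal (fun t => power_term (t - fst V) (S a)
  * power_term (y - snd V) (n - a))).
apply (is_derive_scal_l (K := R_AbsRing) (V := R_NormedModule)
  (fun t => power_term (t - fst V) (S a))).
apply is_derive_power_term.
Qed.

Lemma Dy_homog n c V : Dy (homog (S n) c V) = homog n (shift_y c) V.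
Proof.
apply fun2_ext; intros x y; apply is_derive_unique.
apply is_derive_ext with (fun t =>
  sum_n (fun a => c a (S (n - a))%nat
      * (power_term (x - fst V) a * power_term (t - snd V) (S (n - a)))) n
  + c (S n) 0%nat * power_term (x - fst V) (S n)).
  intros t; unfold homog, sum_n.
  rewrite sum_n_Sm by lia.
  rewrite Nat.sub_diag.
  apply f_equal2.
    apply sum_n_m_Rext; intros a Ha; rewrite Nat.sub_succ_l by lia; reflexivity.
  unfold power_term; simpl; field.
  apply (INR_fact_neq_0 (S n)).
rewrite <- (Rplus_0_r (homog n (shift_y c) V x y)).
apply (is_derive_plus (fun t : R => sum_n (fun a => c a (S (n - a))%nat
      * (power_term (x - fst V) a * power_term (t - snd V) (S (n - a)))) n)
  (fun _ : R => c (S n) 0%nat * power_term (x - fst V) (S n))).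
2: apply (is_derive_const (K := R_AbsRing) (V := R_NormedModule)).
apply (is_derive_sum_n (K := R_AbsRing) (V := R_NormedModule)
  (fun a t => c a (S (n - a))%nat
      * (power_term (x - fst V) a * power_term (t - snd V) (S (n - a))))).
intros a _; unfold shift_y.
apply (is_derive_scal (fun t => power_term (x - fst V) a
  * power_term (t - snd V) (S (n - a)))).
apply (is_derive_scal (fun t => power_term (t - snd V) (S (n - a)))).
apply is_derive_power_term.
Qed.

Lemma Dx_taylor_poly n c V :
  Dx (taylor_poly (S n) c V) = taylor_poly n (shift_x c) V.
Proof.
induction n as [|n IH].
- change (Dx (lin 1 (homog 0 c V) 1 (homog 1 c V)) = homog 0 (shift_x c) V).
  rewrite (Dx_lin 0), Dx_homog by apply smooth_homog.
  rewrite homog_O, Dx_const; apply fun2_ext; intros; unfold lin; ring.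
- change (Dx (lin 1 (taylor_poly (S n) c V) 1 (homog (S (S n)) c V))
    = lin 1 (taylor_poly n (shift_x c) V) 1 (homog (S n) (shift_x c) V)).
  rewrite (Dx_lin 0), IH, Dx_homog; [reflexivity| |].
    apply smooth_taylor_poly.
  apply smooth_homog.
Qed.

Lemma Dy_taylor_poly n c V :
  Dy (taylor_poly (S n) c V) = taylor_poly n (shift_y c) V.
Proof.
induction n as [|n IH].
- change (Dy (lin 1 (homog 0 c V) 1 (homog 1 c V)) = homog 0 (shift_y c) V).
  rewrite (Dy_lin 0), Dy_homog by apply smooth_homog.
  rewrite homog_O, Dy_const; apply fun2_ext; intros; unfold lin; ring.
- change (Dy (lin 1 (taylor_poly (S n) c V) 1 (homog (S (S n)) c V))
    = lin 1 (taylor_poly n (shift_y c) V) 1 (homog (S n) (shift_y c) V)).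
  rewrite (Dy_lin 0), IH, Dy_homog; [reflexivity| |].
    apply smooth_taylor_poly.
  apply smooth_homog.
Qed.

Lemma poly_lt_taylor_poly n c V : poly_lt (S n) (taylor_poly n c V).
Proof.
revert c; induction n as [|n IH]; intros c.
  change (poly_lt 1 (homog 0 c V)); rewrite homog_O.
  split; simpl; [rewrite Dx_const|rewrite Dy_const]; reflexivity.
split; [rewrite Dx_taylor_poly|rewrite Dy_taylor_poly]; apply IH.
Qed.

Lemma taylor_poly_at_V n c V :
  taylor_poly n c V (fst V) (snd V) = c 0%nat 0%nat.
Proof.
induction n as [|n IH]; [simpl; rewrite homog_O; reflexivity|].
simpl; unfold lin; rewrite IH; unfold homog.
rewrite sum_n_m_R0; [ring|].
intros a Ha; unfold power_term; rewrite !Rminus_diag.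
destruct a as [|a].
  rewrite Nat.sub_0_r, (pow_i (S n)) by lia; unfold Rdiv; ring.
rewrite (pow_i (S a)) by lia; unfold Rdiv; ring.
Qed.

Lemma taylor_poly_ext n c c' V :
  (forall a b, (a + b <= n)%nat -> c a b = c' a b) ->
  taylor_poly n c V = taylor_poly n c' V.
Proof.
assert (Hh : forall k, (forall a b, (a + b <= k)%nat -> c a b = c' a b) ->
  homog k c V = homog k c' V).
{ intros k H; apply fun2_ext; intros x y; apply sum_n_m_Rext; intros a Ha.
  rewrite H by lia; reflexivity. }
induction n as [|n IH]; intros H; [apply Hh, H|].
simpl; rewrite IH, Hh; auto.
Qed.

Definition taylor (n : nat) (f : R -> R -> R) (V : R * R) : R -> R -> R :=
  taylor_poly n (fun a b => partial_derive a b f (fst V) (snd V)) V.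

Lemma smooth_taylor n f V : smooth (taylor n f V).
Proof. apply smooth_taylor_poly. Qed.

Lemma taylor_at_V n f V : taylor n f V (fst V) (snd V) = f (fst V) (snd V).
Proof. apply taylor_poly_at_V. Qed.

Lemma Dx_taylor n f V :
  Cn (S n) f -> Dx (taylor (S n) f V) = taylor n (Dx f) V.
Proof.
intros Hf; unfold taylor; rewrite Dx_taylor_poly; apply taylor_poly_ext.
intros a b H; unfold shift_x; rewrite partial_derive_Dx; [reflexivity|].
apply (Cn_le (S n)); [lia|exact Hf].
Qed.

Lemma Dy_taylor n f V : Dy (taylor (S n) f V) = taylor n (Dy f) V.
Proof.
unfold taylor; rewrite Dy_taylor_poly; apply taylor_poly_ext.
intros a b H; rewrite partial_derive_Dy; reflexivity.
Qed.

Lemma partial_derive_taylor n a b f V : (a + b <= n)%nat -> Cn n f ->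
  partial_derive a b (taylor n f V) (fst V) (snd V)
  = partial_derive a b f (fst V) (snd V).
Proof.
revert a b f; induction n as [|n IH]; intros a b f H Hf.
  replace a with 0%nat by lia; replace b with 0%nat by lia; apply taylor_at_V.
destruct b as [|b].
  destruct a as [|a]; [apply taylor_at_V|].
  rewrite <- !partial_derive_Dx.
  - rewrite Dx_taylor by exact Hf; apply IH; [lia|apply Cn_Dx, Hf].
  - apply (Cn_le (S n)); [lia|exact Hf].
  - apply smooth_taylor.
rewrite <- !partial_derive_Dy, Dy_taylor; apply IH; [lia|apply Cn_Dy, Hf].
Qed.

(** * Functions whose derivatives vanish at a vertex *)

Lemma dist2_ge P Q :
  Rabs (fst P - fst Q) <= dist2 P Q /\ Rabs (snd P - snd Q) <= dist2 P Q.
Proof.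
unfold dist2, dist_euc; rewrite <- !sqrt_Rsqr_abs.
split; apply sqrt_le_1_alt; generalize (Rle_0_sqr (fst P - fst Q))
  (Rle_0_sqr (snd P - snd Q)); lra.
Qed.

Lemma dist2_pos P Q : 0 <= dist2 P Q.
Proof. apply sqrt_pos. Qed.

Lemma dist2_sym P Q : dist2 P Q = dist2 Q P.
Proof. apply distance_symm. Qed.

Lemma dist2_refl P : dist2 P P = 0.
Proof. apply distance_refl. Qed.

(** What the remainder of a Taylor expansion of degree [n] at [V] satisfies.
    Unlike being such a remainder, it passes to derivatives and to linear
    combinations without any computation on Taylor polynomials. *)
Fixpoint flat (n : nat) (D : R * R -> Prop) (L : R) (V : R * R)
    (g : R -> R -> R) : Prop :=
  match n with
  | O => forall X, D X -> Rabs (g (fst X) (snd X)) <= L * dist2 V X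
  | S p => g (fst V) (snd V) = 0 /\ flat p D L V (Dx g) /\ flat p D L V (Dy g)
  end.

Lemma flat_lin n D L L' V a f b g : Cn n f -> Cn n g ->
  flat n D L V f -> flat n D L' V g ->
  flat n D (Rabs a * L + Rabs b * L') V (lin a f b g).
Proof.
revert f g; induction n as [|n IH]; intros f g Cf Cg Hf Hg.
  intros X HX; unfold lin.
  eapply Rle_trans; [apply Rabs_triang|]; rewrite !Rabs_mult.
  rewrite Rmult_plus_distr_r, !Rmult_assoc.
  apply Rplus_le_compat; apply Rmult_le_compat_l; auto using Rabs_pos.
destruct Hf as [Hf0 [Hfx Hfy]], Hg as [Hg0 [Hgx Hgy]]; split; [|split].
- unfold lin; rewrite Hf0, Hg0; ring.
- rewrite (Dx_lin n) by assumption; apply IH; auto using Cn_Dx.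
- rewrite (Dy_lin n) by assumption; apply IH; auto using Cn_Dy.
Qed.

Lemma flat_le n D L L' V g : L <= L' -> flat n D L V g -> flat n D L' V g.
Proof.
intros HL; revert g; induction n as [|n IH]; intros g H.
  intros X HX; eapply Rle_trans; [apply H, HX|].
  apply Rmult_le_compat_r; [apply dist2_pos|exact HL].
destruct H as [H0 [H1 H2]]; repeat split; auto.
Qed.

(** A differentiation along an edge of length at most [r] lowers the order of
    flatness by one but multiplies the constant by [2 r], one [r] for each
    coordinate. *)
Lemma flat_Dpow n k D L V g P Q r : 0 <= L -> dist2 P Q <= r ->
  Cn (k + n) g -> flat (k + n) D L V g ->
  flat n D ((2 * r) ^ k * L) V (Dpow P Q k g).
Proof.
intros HL Hr; revert n; induction k as [|k IH]; intros n Cg Hg.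
  simpl; rewrite Rmult_1_l; exact Hg.
assert (Cg' : Cn (k + S n) g) by (rewrite Nat.add_succ_r; exact Cg).
destruct (IH (S n)) as [_ [Hx Hy]]; [exact Cg'| |].
  rewrite Nat.add_succ_r; exact Hg.
assert (Ck := Cn_Dpow (S n) k P Q g Cg').
destruct (dist2_ge P Q) as [B1 B2].
assert (HM : 0 <= (2 * r) ^ k * L).
{ apply Rmult_le_pos; [apply pow_le; generalize (dist2_pos P Q); lra|exact HL]. }
refine (flat_le n D _ _ V _ _ (flat_lin n D _ _ V (fst P - fst Q) _
  (snd P - snd Q) _ (Cn_Dx _ _ Ck) (Cn_Dy _ _ Ck) Hx Hy)).
simpl; set (N := (2 * r) ^ k * L) in *.
replace (2 * r * (2 * r) ^ k * L) with (r * N + r * N) by (unfold N; ring).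
apply Rplus_le_compat; apply Rmult_le_compat_r; lra.
Qed.

Lemma on_line_in_convex D P Q t : convex_set D -> D P -> D Q -> 0 <= t <= 1 ->
  D (fst P + t * (fst Q - fst P), snd P + t * (snd Q - snd P)).
Proof.
intros HD HP HQ Ht; generalize (HD P Q t HP HQ Ht).
replace (fst P + _) with ((1 - t) * fst P + t * fst Q) by ring.
replace (snd P + _) with ((1 - t) * snd P + t * snd Q) by ring; trivial.
Qed.

Lemma dist2_on_line P Q t : 0 <= t <= 1 ->
  dist2 P (fst P + t * (fst Q - fst P), snd P + t * (snd Q - snd P))
  <= dist2 P Q.
Proof.
intros Ht; unfold dist2, dist_euc; apply sqrt_le_1_alt; simpl; unfold Rsqr.
replace ((fst P - (fst P + t * (fst Q - fst P)))
    * (fst P - (fst P + t * (fst Q - fst P))))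
  with (t * t * ((fst P - fst Q) * (fst P - fst Q))) by ring.
replace ((snd P - (snd P + t * (snd Q - snd P)))
    * (snd P - (snd P + t * (snd Q - snd P))))
  with (t * t * ((snd P - snd Q) * (snd P - snd Q))) by ring.
generalize (Rle_0_sqr (fst P - fst Q)) (Rle_0_sqr (snd P - snd Q)).
assert (Ht2 : 0 <= t * t <= 1) by nra.
unfold Rsqr; revert Ht2.
generalize ((fst P - fst Q) * (fst P - fst Q))
  ((snd P - snd Q) * (snd P - snd Q)) (t * t); intros a b s Hs Ha Hb; nra.
Qed.

(** By the mean value theorem on the segment from [V] to [X], inside the convex
    set: each order of flatness gives a factor [2 r], one [r] for each
    coordinate of [X - V]. *)
Lemma flat_bound n D L V g X r : convex_set D -> D V -> D X -> 0 <= L ->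
  dist2 V X <= r -> Cn n g -> flat n D L V g ->
  Rabs (g (fst X) (snd X)) <= (2 * r) ^ n * L * r.
Proof.
intros HD HV HX HL; revert g X HX; induction n as [|n IH]; intros g X HX Hr Cg Hg.
  simpl; rewrite Rmult_1_l; eapply Rle_trans; [apply Hg, HX|].
  apply Rmult_le_compat_l; assumption.
destruct Hg as [Hg0 [Hgx Hgy]].
destruct (MVT_gen (on_line g V X) 0 1 (on_line (Ddir X V g) V X)) as [c [Hc E]].
- intros t _; apply (is_derive_on_line n), Cg.
- intros t _; apply derivable_continuous_pt.
  exists (on_line (Ddir X V g) V X t); apply is_derive_Reals.
  apply (is_derive_on_line n), Cg.
- rewrite Rmin_left, Rmax_right in Hc by lra.
  rewrite on_line_0, on_line_1, Hg0 in E.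
  replace (g (fst X) (snd X)) with (on_line (Ddir X V g) V X c) by lra.
  set (Y := (fst V + c * (fst X - fst V), snd V + c * (snd X - snd V))).
  assert (HY : D Y) by (apply on_line_in_convex; assumption).
  assert (Yr : dist2 V Y <= r).
  { eapply Rle_trans; [apply dist2_on_line, Hc|exact Hr]. }
  generalize (IH (Dx g) Y HY Yr (Cn_Dx _ _ Cg) Hgx).
  generalize (IH (Dy g) Y HY Yr (Cn_Dy _ _ Cg) Hgy).
  change (on_line (Ddir X V g) V X c) with (Ddir X V g (fst Y) (snd Y)).
  rewrite Ddir_lin; unfold lin.
  destruct (dist2_ge X V) as [B1 B2]; rewrite dist2_sym in B1, B2.
  generalize (Dx g (fst Y) (snd Y)) (Dy g (fst Y) (snd Y)); intros a b Hb Ha.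
  eapply Rle_trans; [apply Rabs_triang|]; rewrite !Rabs_mult.
  simpl; set (N := (2 * r) ^ n * L * r) in *.
  replace (2 * r * (2 * r) ^ n * L * r) with (r * N + r * N) by (unfold N; ring).
  apply Rplus_le_compat; apply Rmult_le_compat; auto using Rabs_pos; lra.
Qed.

(** The recursion follows that of [flat], so that the mixed derivatives are
    taken in every order of differentiation. *)
Fixpoint lip_jets (n : nat) (D : R * R -> Prop) (L : R) (g : R -> R -> R) : Prop :=
  match n with
  | O => forall P Q, D P -> D Q ->
      Rabs (g (fst P) (snd P) - g (fst Q) (snd Q)) <= L * dist2 P Q
  | S p => lip_jets p D L (Dx g) /\ lip_jets p D L (Dy g)
  end.

(** By equality of mixed derivatives, the [n + 1] canonical ones suffice. *)
Lemma lip_jets_intro n D L g : Cn n g ->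
  (forall j, (j <= n)%nat -> lip_jets 0 D L (partial_derive (n - j) j g)) ->
  lip_jets n D L g.
Proof.
revert g; induction n as [|n IH]; intros g Cg H; [exact (H 0%nat (le_n 0))|].
split; apply IH; auto using Cn_Dx, Cn_Dy; intros j Hj.
- rewrite partial_derive_Dx by (apply (Cn_le (S n)); [lia|exact Cg]).
  rewrite <- Nat.sub_succ_l by lia; apply H; lia.
- rewrite partial_derive_Dy; apply (H (S j)); lia.
Qed.

Lemma flat_taylor_remainder n D L V f : D V -> Cn n f -> lip_jets n D L f ->
  flat n D L V (lin 1 f (-1) (taylor n f V)).
Proof.
intros HV; revert f; induction n as [|n IH]; intros f Cf Hf.
  intros X HX; unfold lin.
  replace (taylor 0 f V (fst X) (snd X)) with (f (fst V) (snd V)).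
    rewrite dist2_sym.
    replace (1 * _ + _) with (f (fst X) (snd X) - f (fst V) (snd V)) by ring.
    apply Hf; assumption.
  unfold taylor; simpl; rewrite homog_O; reflexivity.
destruct Hf as [Hx Hy]; split; [|split].
- unfold lin; rewrite taylor_at_V; ring.
- rewrite (Dx_lin n), Dx_taylor by (assumption || apply smooth_taylor).
  apply IH; auto using Cn_Dx.
- rewrite (Dy_lin n), Dy_taylor by (assumption || apply smooth_taylor).
  apply IH; auto using Cn_Dy.
Qed.

(** The bound does not depend on the orders [b1], [b2]: each differentiation
    takes a factor [2 r] away from [flat_bound] and puts it in the constant of
    [flat_Dpow]. *)
Lemma Dtri_flat_bound m b1 b2 D L W P Q V g X r : convex_set D ->
  D V -> D X -> 0 <= L ->
  dist2 P W <= r -> dist2 Q W <= r -> dist2 V X <= r ->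
  (b1 + b2 <= m)%nat -> Cn m g -> flat m D L V g ->
  Rabs (Dtri W P Q (b1, b2) g X) <= (2 * r) ^ m * L * r.
Proof.
intros HD HV HX HL HP HQ Hr Hb Cg Hg.
assert (H2r : 0 <= 2 * r) by (generalize (dist2_pos V X); lra).
replace m with (b2 + (b1 + (m - (b1 + b2))))%nat in Cg, Hg by lia.
assert (H1 := flat_Dpow _ b2 D L V g Q W r HL HQ Cg Hg).
assert (C1 := Cn_Dpow _ b2 Q W g Cg).
assert (HL1 : 0 <= (2 * r) ^ b2 * L) by (apply Rmult_le_pos; auto using pow_le).
assert (H2 := flat_Dpow _ b1 D _ V _ P W r HL1 HP C1 H1).
assert (C2 := Cn_Dpow _ b1 P W _ C1).
assert (HL2 : 0 <= (2 * r) ^ b1 * ((2 * r) ^ b2 * L))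
  by (apply Rmult_le_pos; auto using pow_le).
unfold Dtri; simpl.
eapply Rle_trans; [apply (flat_bound _ D _ V _ X r HD HV HX HL2 Hr C2 H2)|].
replace m with (m - (b1 + b2) + (b1 + b2))%nat at 2 by lia.
rewrite !pow_add; right; ring.
Qed.

Lemma Dpow_lin k P Q a f b g : Cn k f -> Cn k g ->
  Dpow P Q k (lin a f b g) = lin a (Dpow P Q k f) b (Dpow P Q k g).
Proof.
induction k as [|k IH]; intros Cf Cg; [reflexivity|].
assert (Ck : forall h, Cn (S k) h -> Cn 1 (Dpow P Q k h)).
{ intros h Ch; apply Cn_Dpow; rewrite Nat.add_1_r; exact Ch. }
change (Ddir P Q (Dpow P Q k (lin a f b g))
  = lin a (Ddir P Q (Dpow P Q k f)) b (Ddir P Q (Dpow P Q k g))).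
rewrite IH by (apply (Cn_le (S k)); auto); rewrite !Ddir_lin.
rewrite (Dx_lin 0), (Dy_lin 0) by auto.
apply fun2_ext; intros; unfold lin; ring.
Qed.

Lemma Dtri_lin n W P Q b1 b2 a f b g X : (b1 + b2 <= n)%nat -> Cn n f -> Cn n g ->
  Dtri W P Q (b1, b2) (lin a f b g) X
  = a * Dtri W P Q (b1, b2) f X + b * Dtri W P Q (b1, b2) g X.
Proof.
intros Hn Cf Cg; unfold Dtri; simpl.
rewrite Dpow_lin by (apply (Cn_le n); [lia|assumption]).
rewrite Dpow_lin; [reflexivity| |]; apply Cn_Dpow, (Cn_le n); auto; lia.
Qed.

Lemma gen_taylor_lin m V1 V2 V3 a f b g : Cn m f -> Cn m g ->
  gen_taylor m V1 V2 V3 (lin a f b g)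
  = lin a (gen_taylor m V1 V2 V3 f) b (gen_taylor m V1 V2 V3 g).
Proof.
intros Cf Cg; apply fun2_ext; intros x y; unfold lin at 2.
rewrite !gen_taylor_form; cbv zeta; unfold taylor_form.
set (u := lambda2 V1 V2 V3 (x, y) + lambda3 V1 V2 V3 (x, y)).
set (v := lambda2 V1 V2 V3 (x, y)).
match goal with |- _ + (?s + ?t) = a * (_ + (?s1 + ?t1)) + b * (_ + (?s2 + ?t2)) =>
  assert (E1 : s = a * s1 + b * s2); [|assert (E2 : t = a * t1 + b * t2)] end.
- rewrite <- !sum_n_m_Rscal, <- sum_n_m_Rplus; apply sum_n_m_Rext; intros j Hj.
  unfold edge_diff; rewrite !(Dtri_lin m) by (lia || assumption); ring.
- rewrite <- !sum_n_m_Rscal, <- sum_n_m_Rplus; apply sum_n_m_Rext; intros i Hi.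
  rewrite <- !sum_n_m_Rscal, <- sum_n_m_Rplus; apply sum_n_m_Rext; intros j Hj.
  unfold face_diff; rewrite !(Dtri_lin m) by (lia || assumption); ring.
- rewrite E1, E2; unfold lin; ring.
Qed.

(** * Derivatives of a fixed function of affine functions *)

(** A derivative counts once for each order in which it can be taken, which
    makes the recursion that of the chain rule. *)
Fixpoint jet_size (n : nat) (w : R -> R -> R) (u v : R) : R :=
  match n with
  | O => Rabs (w u v)
  | S p => jet_size p (Dx w) u v + jet_size p (Dy w) u v
  end.

Lemma jet_size_pos n w u v : 0 <= jet_size n w u v.
Proof.
revert w; induction n as [|n IH]; intros w; [apply Rabs_pos|].
apply Rplus_le_le_0_compat; apply IH.
Qed.

Lemma jet_size_lin n a f b g u v : Cn n f -> Cn n g ->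
  jet_size n (lin a f b g) u v
  <= Rabs a * jet_size n f u v + Rabs b * jet_size n g u v.
Proof.
revert f g; induction n as [|n IH]; intros f g Cf Cg.
  simpl; unfold lin; eapply Rle_trans; [apply Rabs_triang|].
  rewrite !Rabs_mult; apply Rle_refl.
simpl; rewrite (Dx_lin n), (Dy_lin n) by assumption.
generalize (IH _ _ (Cn_Dx _ _ Cf) (Cn_Dx _ _ Cg)).
generalize (IH _ _ (Cn_Dy _ _ Cf) (Cn_Dy _ _ Cg)); lra.
Qed.

Lemma jet_size_lin_le n a f b g u v G : Cn n f -> Cn n g ->
  Rabs a <= G -> Rabs b <= G ->
  jet_size n (lin a f b g) u v <= G * (jet_size n f u v + jet_size n g u v).
Proof.
intros Cf Cg Ha Hb; eapply Rle_trans; [apply jet_size_lin; assumption|].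
rewrite Rmult_plus_distr_l.
apply Rplus_le_compat; apply Rmult_le_compat_r; auto using jet_size_pos.
Qed.

(** Each differentiation of a composite with affine functions brings out one
    of their coefficients. *)
Lemma partial_derive_comp_affine_le i j w p q c p' q' c' x y G :
  Cn (i + j) w -> Rabs p <= G -> Rabs q <= G -> Rabs p' <= G -> Rabs q' <= G ->
  Rabs (partial_derive i j (comp_affine w p q c p' q' c') x y)
  <= G ^ (i + j) * jet_size (i + j) w (affine p q c x y) (affine p' q' c' x y).
Proof.
intros Cw Hp Hq Hp' Hq'.
assert (HG : 0 <= G) by (generalize (Rabs_pos p); lra).
revert w Cw; induction j as [|j IH]; intros w Cw.
- rewrite Nat.add_0_r in *; revert w Cw; induction i as [|i IHi]; intros w Cw.
    simpl; rewrite Rmult_1_l; apply Rle_refl.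
  rewrite <- partial_derive_Dx
    by (apply (Cn_le (S i)); [lia|apply Cn_comp_affine, Cw]).
  destruct (Dxy_comp_affine i w p q c p' q' c' Cw) as [E _]; rewrite E.
  eapply Rle_trans; [apply IHi, Cn_lin; auto using Cn_Dx, Cn_Dy|].
  simpl; rewrite (Rmult_comm G), Rmult_assoc.
  apply Rmult_le_compat_l; [apply pow_le, HG|].
  apply jet_size_lin_le; auto using Cn_Dx, Cn_Dy.
- rewrite <- partial_derive_Dy; rewrite Nat.add_succ_r in *.
  destruct (Dxy_comp_affine (i + j) w p q c p' q' c' Cw) as [_ E]; rewrite E.
  eapply Rle_trans; [apply IH, Cn_lin; auto using Cn_Dx, Cn_Dy|].
  simpl; rewrite (Rmult_comm G), Rmult_assoc.
  apply Rmult_le_compat_l; [apply pow_le, HG|].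
  apply jet_size_lin_le; auto using Cn_Dx, Cn_Dy.
Qed.

Lemma jet_size_sum n (c : nat -> R) (F : nat -> R -> R -> R) a b u v :
  (forall k, smooth (F k)) ->
  jet_size n (fun x y => sum_n_m (fun k => c k * F k x y) a b) u v
  <= sum_n_m (fun k => Rabs (c k) * jet_size n (F k) u v) a b.
Proof.
intros SF.
assert (J0 : jet_size n (fun _ _ => 0) u v = 0).
{ induction n as [|n IH]; simpl; [apply Rabs_R0|].
  rewrite Dx_const, Dy_const, IH; ring. }
set (s := fun b x y => sum_n_m (fun k => c k * F k x y) a b).
assert (Ss : forall b, smooth (s b)).
{ intros d; apply (smooth_sum (fun k x y => c k * F k x y)); intros k.
  apply (smooth_mult (fun _ _ => c k)); [apply smooth_const|apply SF]. }
assert (Hz : forall d, (d < a)%nat -> s d = fun _ _ => 0).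
{ intros d Hd; apply fun2_ext; intros; unfold s.
  rewrite sum_n_m_zero by exact Hd; reflexivity. }
assert (Step : forall d, (a <= d)%nat ->
  jet_size n (s d) u v <= match d with 0%nat => 0 | S d' => jet_size n (s d') u v end
    + Rabs (c d) * jet_size n (F d) u v).
{ intros [|d] Hd.
    replace (s 0%nat) with (lin 0 (fun _ _ => 0) (c 0%nat) (F 0%nat)).
      eapply Rle_trans; [apply jet_size_lin; [apply smooth_const|apply SF]|].
      rewrite J0, Rmult_0_r; apply Rle_refl.
    apply fun2_ext; intros; unfold s, lin; replace a with 0%nat by lia.
    rewrite sum_n_n; ring.
  replace (s (S d)) with (lin 1 (s d) (c (S d)) (F (S d))).
    eapply Rle_trans; [apply jet_size_lin; [apply Ss|apply SF]|].
    rewrite Rabs_R1, Rmult_1_l; apply Rle_refl.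
  apply fun2_ext; intros; unfold s, lin; rewrite sum_n_Sm by lia.
  rewrite Rmult_1_l; reflexivity. }
change (jet_size n (s b) u v
  <= sum_n_m (fun k => Rabs (c k) * jet_size n (F k) u v) a b).
destruct (Nat.le_gt_cases a b) as [Hab|Hab].
2: rewrite Hz, J0, sum_n_m_zero by exact Hab; apply Rle_refl.
induction b as [|b IH].
  eapply Rle_trans; [apply Step, Hab|]; replace a with 0%nat by lia.
  rewrite sum_n_n; lra.
eapply Rle_trans; [apply Step, Hab|].
rewrite sum_n_Sm by lia; apply Rplus_le_compat_r.
destruct (Nat.eq_dec a (S b)) as [E|E].
  rewrite Hz, J0, sum_n_m_zero by lia; apply Rle_refl.
apply IH; lia.
Qed.

(** The constant [K] depends only on [n], [m] and the polynomials [S_poly] and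
    [S_prod]: the final estimate is uniform in the triangle because the triangle
    does not enter here. *)
Lemma jet_size_taylor_form_le n m : exists K, 0 <= K /\ forall M d e,
  (forall j, (1 <= j <= m)%nat -> Rabs (d j) <= M) ->
  (forall i j, (1 <= i <= m)%nat -> (1 <= j <= m - i + 1)%nat ->
     Rabs (e i j) <= M) ->
  jet_size n (taylor_form m d e) 0 0 <= K * M.
Proof.
set (phi := fun j u (_ : R) => S_poly j u / INR (fact j)).
set (psi := fun i j u v => S_prod i j u v / (INR (fact i) * INR (fact j))).
assert (Sphi : forall j, smooth (phi j)).
{ intros j; apply smooth_mult; [apply smooth_S_poly|apply smooth_const]. }
assert (Spsi : forall i j, smooth (psi i j)).
{ intros i j; apply smooth_mult; [apply smooth_S_prod|apply smooth_const]. }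
set (K1 := sum_n_m (fun j => jet_size n (phi j) 0 0) 1 m).
set (K2 := sum_n_m (fun i =>
  sum_n_m (fun j => jet_size n (psi i j) 0 0) 1 (m - i + 1)) 1 m).
assert (P0 : forall a k l, (forall i, 0 <= a i) -> 0 <= sum_n_m a k l).
{ intros a k l Ha; replace 0 with (sum_n_m (fun _ : nat => 0) k l).
    apply sum_n_m_Rle; auto.
  apply sum_n_m_R0; reflexivity. }
exists (K1 + K2); split.
  apply Rplus_le_le_0_compat; apply P0; intros i; [apply jet_size_pos|].
  apply P0; intros j; apply jet_size_pos.
intros M d e Hd He.
set (inner := fun i u v =>
  sum_n_m (fun j => e i j * psi i j u v) 1 (m - i + 1)).
assert (Si : forall i, smooth (inner i)).
{ intros i; apply (smooth_sum (fun j u v => e i j * psi i j u v)); intros j.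
  apply (smooth_mult (fun _ _ => e i j)); [apply smooth_const|apply Spsi]. }
set (s1 := fun u v => sum_n_m (fun j => d j * phi j u v) 1 m).
set (s2 := fun u v => sum_n_m (fun i => 1 * inner i u v) 1 m).
replace (taylor_form m d e) with (lin 1 s1 1 s2).
2: { apply fun2_ext; intros; unfold lin, s1, s2, taylor_form; rewrite !Rmult_1_l.
     f_equal; apply sum_n_m_Rext; intros; apply Rmult_1_l. }
eapply Rle_trans; [apply jet_size_lin|].
- apply (smooth_sum (fun j u v => d j * phi j u v)); intros j.
  apply (smooth_mult (fun _ _ => d j)); [apply smooth_const|apply Sphi].
- apply (smooth_sum (fun i u v => 1 * inner i u v)); intros i.
  apply (smooth_mult (fun _ _ => 1)); [apply smooth_const|apply Si].
- rewrite Rabs_R1, !Rmult_1_l, Rmult_plus_distr_r.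
  apply Rplus_le_compat.
    eapply Rle_trans; [apply (jet_size_sum n d phi), Sphi|].
    unfold K1; rewrite Rmult_comm, <- sum_n_m_Rscal; apply sum_n_m_Rle.
    intros j Hj; apply Rmult_le_compat_r; [apply jet_size_pos|auto].
  eapply Rle_trans; [apply (jet_size_sum n (fun _ => 1) inner), Si|].
  unfold K2; rewrite Rmult_comm, <- sum_n_m_Rscal; apply sum_n_m_Rle.
  intros i Hi; rewrite Rabs_R1, Rmult_1_l, <- sum_n_m_Rscal.
  eapply Rle_trans; [apply (jet_size_sum n (e i) (psi i)), Spsi|].
  apply sum_n_m_Rle.
  intros j Hj; apply Rmult_le_compat_r; [apply jet_size_pos|auto].
Qed.

(** * Uniqueness of the derivatives on a convex domain *)

Lemma partial_derive_interior_0 D g i j :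
  (forall P, locally P D -> g (fst P) (snd P) = 0) ->
  forall P, locally P D -> partial_derive i j g (fst P) (snd P) = 0.
Proof.
assert (HD : forall h, (forall P, locally P D -> h (fst P) (snd P) = 0) ->
  forall P : R * R, locally P D ->
    Dx h (fst P) (snd P) = 0 /\ Dy h (fst P) (snd P) = 0).
{ intros h Hh [x y] HP; simpl.
  assert (L2 : locally_2d (fun u v => h u v = 0) x y).
  { apply locally_2d_locally.
    apply (filter_imp (fun z : R * R => locally z D)); [apply Hh|].
    apply locally_locally, HP. }
  split.
  - unfold Dx; rewrite (Derive_ext_loc _ (fun _ => 0)); [apply Derive_const|].
    apply (locally_2d_1d_const_y _ _ _ L2).
  - unfold Dy; rewrite (Derive_ext_loc _ (fun _ => 0)); [apply Derive_const|].
    apply (locally_2d_1d_const_x _ _ _ L2). }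
revert g; induction j as [|j IH]; intros g Hg.
- induction i as [|i IHi]; [exact Hg|].
  rewrite partial_derive_Sx; intros P HP; apply (HD _ IHi P HP).
- rewrite <- partial_derive_Dy; apply IH; intros P HP; apply (HD _ Hg P HP).
Qed.

(** The homothety of center [P] and ratio [t] maps a neighbourhood of [P0] inside
    [D] onto a neighbourhood of the given point. *)
Lemma convex_interior D P P0 t : convex_set D -> D P -> locally P0 D ->
  0 < t <= 1 ->
  locally (fst P + t * (fst P0 - fst P), snd P + t * (snd P0 - snd P)) D.
Proof.
intros HD HP [eps Heps] [Ht0 Ht1].
assert (Hte : 0 < t * eps) by (apply Rmult_lt_0_compat; [exact Ht0|apply cond_pos]).
exists (mkposreal _ Hte); intros [x y] [Bx By]; simpl in Bx, By.
change (Rabs (x - (fst P + t * (fst P0 - fst P))) < t * eps) in Bx.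
change (Rabs (y - (snd P + t * (snd P0 - snd P))) < t * eps) in By.
set (Y := (fst P + (x - fst P) / t, snd P + (y - snd P) / t)).
assert (Scale : forall a, Rabs (t * a) < t * eps -> Rabs a < eps).
{ intros a; rewrite Rabs_mult, (Rabs_pos_eq t) by lra.
  apply Rmult_lt_reg_l, Ht0. }
assert (HY : D Y).
{ apply Heps; split.
  - change (Rabs (fst Y - fst P0) < eps); apply Scale.
    replace (t * (fst Y - fst P0)) with (x - (fst P + t * (fst P0 - fst P))).
      exact Bx.
    unfold Y; simpl; field; lra.
  - change (Rabs (snd Y - snd P0) < eps); apply Scale.
    replace (t * (snd Y - snd P0)) with (y - (snd P + t * (snd P0 - snd P))).
      exact By.
    unfold Y; simpl; field; lra. }
replace (x, y) with ((1 - t) * fst P + t * fst Y, (1 - t) * snd P + t * snd Y).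
  apply HD; [exact HP|exact HY|lra].
unfold Y; simpl; f_equal; field; lra.
Qed.

Lemma continuous_on_line f P Q t : Cn 0 f -> continuous (on_line f P Q) t.
Proof.
intros Cf; unfold on_line.
apply (continuous_comp_2 (fun t => fst P + t * (fst Q - fst P))
  (fun t => snd P + t * (snd Q - snd P)) f).
- apply (ex_derive_continuous (K := R_AbsRing) (V := R_NormedModule)).
  auto_derive; exact I.
- apply (ex_derive_continuous (K := R_AbsRing) (V := R_NormedModule)).
  auto_derive; exact I.
- apply (continuity_2d_pt_filterlim f), (Cn_continuity 0), Cf.
Qed.

(** The derivatives agree in the interior of [D], and by continuity at [P]: the
    segment from an interior point [P0] to [P] is interior up to [P]. *)
Lemma partial_derive_unique_on D i j f g : convex_set D ->
  (exists P, locally P D) -> Cn (i + j) f -> Cn (i + j) g ->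
  (forall P, D P -> f (fst P) (snd P) = g (fst P) (snd P)) ->
  forall P, D P -> partial_derive i j f (fst P) (snd P)
                   = partial_derive i j g (fst P) (snd P).
Proof.
intros HD [P0 HP0] Cf Cg E P HP.
set (h := partial_derive i j (lin 1 f (-1) g)).
assert (Ch : Cn 0 h).
{ apply Cn_partial_derive; rewrite Nat.add_0_r; apply Cn_lin; assumption. }
assert (H0 : forall Q, locally Q D -> h (fst Q) (snd Q) = 0).
{ apply partial_derive_interior_0; intros [x y] HQ; unfold lin.
  generalize (E (x, y) (locally_singleton _ _ HQ)); simpl; lra. }
assert (HhP : h (fst P) (snd P) = 0).
{ rewrite <- (on_line_0 h P P0); apply continuous_eq_0.
    apply continuous_on_line, Ch.
  intros t Ht.
  apply (H0 (fst P + t * (fst P0 - fst P), snd P + t * (snd P0 - snd P))).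
  apply convex_interior; assumption. }
unfold h in HhP; rewrite partial_derive_lin in HhP by assumption.
unfold lin in HhP; lra.
Qed.

Lemma lipschitz_on_common D (g : nat -> R -> R -> R) m :
  (forall j, (j <= m)%nat -> lipschitz_on D (g j)) ->
  exists L, 0 <= L /\ forall j, (j <= m)%nat -> lip_jets 0 D L (g j).
Proof.
intros H.
assert (Mono : forall L L' h, L <= L' -> lip_jets 0 D L h -> lip_jets 0 D L' h).
{ intros L L' h HL Hh P Q HP HQ; eapply Rle_trans; [apply Hh; assumption|].
  apply Rmult_le_compat_r; [apply dist2_pos|exact HL]. }
induction m as [|m IH].
  destruct (H 0%nat) as [L HL]; [lia|]; exists (Rmax 0 L); split; [apply Rmax_l|].
  intros j Hj; replace j with 0%nat by lia.
  apply (Mono L); [apply Rmax_r|exact HL].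
destruct IH as [L1 [HL1 H1]]; [intros j Hj; apply H; lia|].
destruct (H (S m)) as [L2 H2]; [lia|].
exists (Rmax L1 L2); split; [eapply Rle_trans; [apply HL1|apply Rmax_l]|].
intros j Hj; destruct (Nat.eq_dec j (S m)) as [->|Hne].
  apply (Mono L2); [apply Rmax_r|exact H2].
apply (Mono L1); [apply Rmax_l|apply H1; lia].
Qed.

(** * The error estimate *)

Lemma diam_ge V1 V2 V3 : let r := diam V1 V2 V3 in
  dist2 V1 V2 <= r /\ dist2 V1 V3 <= r /\ dist2 V2 V3 <= r.
Proof.
unfold diam; repeat split.
- apply Rmax_l.
- eapply Rle_trans; [apply Rmax_l|apply Rmax_r].
- eapply Rle_trans; [apply Rmax_r|apply Rmax_r].
Qed.

(** The coefficients are at most [4 M], four being the number of derivatives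
    in [face_diff]; each differentiation brings out a coefficient of
    [lambda2] or [lambda2 + lambda3], at most [r / |A|].  The value [g V1]
    disappears since [i + j >= 1]. *)
Lemma gen_taylor_flat_le m i j : (1 <= i + j)%nat ->
  exists K, 0 <= K /\ forall D L V1 V2 V3 g, convex_set D -> 0 <= L ->
    D V1 -> D V2 -> D V3 -> A V1 V2 V3 <> 0 -> Cn m g -> flat m D L V1 g ->
    let r := diam V1 V2 V3 in
    Rabs (partial_derive i j (gen_taylor m V1 V2 V3 g) (fst V1) (snd V1))
    <= (r / Rabs (A V1 V2 V3)) ^ (i + j) * (K * ((2 * r) ^ m * L * r)).
Proof.
intros Hij; destruct (jet_size_taylor_form_le (i + j) m) as [K [HK HKM]].
exists (4 * K); split; [lra|].
intros D L V1 V2 V3 g HD HL D1 D2 D3 HA Cg Hg r.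
destruct (diam_ge V1 V2 V3) as [R12 [R13 R23]]; fold r in R12, R13, R23.
set (M := (2 * r) ^ m * L * r).
assert (Bd : forall W P Q b1 b2 X, dist2 P W <= r -> dist2 Q W <= r -> D X ->
  dist2 V1 X <= r -> (b1 + b2 <= m)%nat ->
  Rabs (Dtri W P Q (b1, b2) g X) <= M).
{ intros; apply (Dtri_flat_bound m _ _ D L _ _ _ V1); assumption. }
assert (R11 : dist2 V1 V1 <= r)
  by (rewrite dist2_refl; generalize (dist2_pos V1 V2); lra).
assert (R21 : dist2 V2 V1 <= r) by (rewrite dist2_sym; exact R12).
assert (R31 : dist2 V3 V1 <= r) by (rewrite dist2_sym; exact R13).
assert (R32 : dist2 V3 V2 <= r) by (rewrite dist2_sym; exact R23).
assert (HM : 0 <= M).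
{ eapply Rle_trans; [apply Rabs_pos|].
  apply (Bd V1 V2 V3 0%nat 0%nat V1); auto; lia. }
set (w := taylor_form m (edge_diff V1 V2 V3 g) (face_diff V1 V2 V3 g)).
assert (Hw : jet_size (i + j) w 0 0 <= K * (4 * M)).
{ apply HKM.
  - intros k Hk; unfold edge_diff; eapply Rle_trans; [apply Rabs_triang|].
    rewrite Rabs_Ropp.
    assert (B1 := Bd V1 V2 V3 0%nat (k - 1)%nat V3 R21 R31 D3 R13 ltac:(lia)).
    assert (B2 := Bd V1 V2 V3 0%nat (k - 1)%nat V1 R21 R31 D1 R11 ltac:(lia)).
    lra.
  - intros k l Hk Hl; unfold face_diff.
    assert (B1 := Bd V2 V1 V3 (l - 1)%nat (k - 1)%nat V2 R12 R32 D2 R12 ltac:(lia)).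
    assert (B2 := Bd V2 V1 V3 (l - 1)%nat (k - 1)%nat V1 R12 R32 D1 R11 ltac:(lia)).
    assert (B3 := Bd V3 V1 V2 (l - 1)%nat (k - 1)%nat V3 R13 R23 D3 R13 ltac:(lia)).
    assert (B4 := Bd V3 V1 V2 (l - 1)%nat (k - 1)%nat V1 R13 R23 D1 R11 ltac:(lia)).
    eapply Rle_trans; [apply Rabs_triang|].
    rewrite !Rabs_mult, !pow_1_abs, !Rmult_1_l.
    eapply Rle_trans; [apply Rplus_le_compat; apply Rabs_triang|].
    rewrite !Rabs_Ropp; lra. }
rewrite gen_taylor_at_barycentric; fold w.
assert (Sw : smooth w) by apply smooth_taylor_form.
rewrite partial_derive_lin;
  [|apply smooth_const|apply smooth_at_barycentric; assumption].
rewrite partial_derive_const by exact Hij; unfold lin.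
rewrite Rmult_0_r, Rplus_0_l, Rmult_1_l, at_barycentric_affine by exact HA.
set (G := r / Rabs (A V1 V2 V3)).
assert (HG : forall z, Rabs z <= r -> Rabs (z / A V1 V2 V3) <= G).
{ intros z Hz; unfold Rdiv; rewrite Rabs_mult, Rabs_inv.
  apply Rmult_le_compat_r; [|exact Hz].
  apply Rlt_le, Rinv_0_lt_compat, Rabs_pos_lt, HA. }
eapply Rle_trans.
  apply (partial_derive_comp_affine_le i j w _ _ _ _ _ _ _ _ G); [apply Sw|..];
    apply HG.
  - eapply Rle_trans; [apply (dist2_ge V3 V2)|exact R32].
  - eapply Rle_trans; [apply (dist2_ge V2 V3)|exact R23].
  - eapply Rle_trans; [apply (dist2_ge V3 V1)|exact R31].
  - eapply Rle_trans; [apply (dist2_ge V1 V3)|exact R13].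
replace (affine _ _ _ _ _) with 0 by (unfold affine; field; exact HA).
replace (affine _ _ _ _ _) with 0 by (unfold affine; field; exact HA).
apply Rmult_le_compat_l.
  apply pow_le, Rmult_le_pos; [generalize (dist2_pos V1 V2); lra|].
  apply Rlt_le, Rinv_0_lt_compat, Rabs_pos_lt, HA.
eapply Rle_trans; [exact Hw|]; right; ring.
Qed.

Theorem corollary2p9 (m : nat) (hm : (1 <= m)%nat)
    (D : R * R -> Prop) (hD : compact_convex_domain D)
    (f : R * R -> R) (hf : Cm1_on m D f)
    (alpha beta : nat) (hab : (1 <= alpha + beta <= m)%nat) :
  exists C : R -> R,
    forall F : R -> R -> R, Cm_extension m D f F ->
    forall V1 V2 V3 : R * R, D V1 -> D V2 -> D V3 -> A V1 V2 V3 <> 0 ->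
      let r := diam V1 V2 V3 in
      let S := / Rabs (A V1 V2 V3) in
      Rabs (partial_derive alpha beta (gen_taylor m V1 V2 V3 F) (fst V1) (snd V1)
            - partial_derive alpha beta F (fst V1) (snd V1))
      <= C (r ^ 2 * S) * r ^ (m + 1 - (alpha + beta)).
Proof.
destruct hD as [_ [HD Hint]], hf as [F0 [[CF0 EF0] HL0]].
destruct (lipschitz_on_common D _ m HL0) as [L [HL HLj]].
destruct (gen_taylor_flat_le m alpha beta) as [K [HK Hflat]]; [lia|].
exists (fun q => K * 2 ^ m * L * q ^ (alpha + beta)).
intros F [CF EF] V1 V2 V3 D1 D2 D3 HA r S.
assert (LF : lip_jets m D L F).
{ apply lip_jets_intro; [exact CF|]; intros j Hj P Q HP HQ.
  rewrite !(partial_derive_unique_on D (m - j) j F F0); auto.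
  - apply HLj; assumption.
  - apply (Cn_le m); [lia|exact CF].
  - apply (Cn_le m); [lia|exact CF0].
  - intros X HX; rewrite EF, EF0 by exact HX; reflexivity.
  - apply (Cn_le m); [lia|exact CF].
  - apply (Cn_le m); [lia|exact CF0].
  - intros X HX; rewrite EF, EF0 by exact HX; reflexivity. }
set (T := taylor m F V1).
assert (ST : smooth T) by apply smooth_taylor.
assert (Hg := flat_taylor_remainder m D L V1 F D1 CF LF); fold T in Hg.
assert (Cg : Cn m (lin 1 F (-1) T)) by (apply Cn_lin; [exact CF|apply ST]).
generalize (Hflat D L V1 V2 V3 _ HD HL D1 D2 D3 HA Cg Hg); fold r.
rewrite gen_taylor_lin by (exact CF || apply ST).
rewrite (gen_taylor_reproduces m V1 V2 V3 T)
  by (exact HA || exact ST || apply poly_lt_taylor_poly).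
rewrite partial_derive_lin by (apply smooth_gen_taylor, HA || apply ST).
unfold lin at 1.
replace (partial_derive alpha beta T (fst V1) (snd V1))
  with (partial_derive alpha beta F (fst V1) (snd V1))
  by (symmetry; apply partial_derive_taylor; [lia|exact CF]).
intros H; eapply Rle_trans; [|eapply Rle_trans; [exact H|]].
  right; f_equal; lra.
right; fold S; unfold Rdiv; fold S.
rewrite !Rpow_mult_distr, <- pow_mult.
replace ((2 * (alpha + beta))%nat) with ((alpha + beta) + (alpha + beta))%nat by lia.
transitivity (S ^ (alpha + beta) * K * 2 ^ m * L * r ^ (alpha + beta) * r ^ (m + 1)).
  rewrite (pow_add r m 1); ring.
replace (r ^ (m + 1)) with (r ^ (alpha + beta) * r ^ (m + 1 - (alpha + beta)))
  by (rewrite <- pow_add; f_equal; lia).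
rewrite (pow_add r (alpha + beta) (alpha + beta)); ring.
Qed.
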